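(* For all sufficiently small $\epsilon>0$, with perturbation data $\pi$ supported on the two curves $P_1$ and $P_2$ (with perturbation function $\epsilon\sin$ on $P_1$ and $2\epsilon\sin$ on $P_2$), the perturbed unreduced moduli space $R^\sharp_\pi(B^3,A_1\cup A_2)$ is a disjoint union of two circles, parameterized by $\beta\in S^1=\mathbb{R}/2\pi\mathbb{Z}$ and $i=1,2$. The restriction map $R^\sharp_\pi(B^3,A_1\cup A_2)\to R(S^2,\{m,b,c,n\})$ is an immersion, given by $$\rho_i(\beta)=\left(-\tau_i(\beta)+\tfrac{\pi}{2}+\beta+\epsilon\sin\beta,\ -\tau_i(\beta)+\tfrac{\pi}{2}+\beta-\epsilon\sin\beta\right),\quad i=1,2,$$ where $\tau_1(\beta)=\arcsin(-\tfrac12\sin\beta)$ and $\tau_2(\beta)=\pi-\tau_1(\beta)$. As $\epsilon\to0$, this immersion limits to a generically 4-1 map onto the diagonal arc $\gamma=\theta$ in the pillowcase.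
   Context: Notation. $SU(2)$ is identified with the unit quaternions; $C(\mathbf i)$ is the set of pure (traceless) unit quaternions; $e^{tQ}=\cos t+\sin t\,Q$ for $Q\in C(\mathbf i)$. Bars denote inverses in groups and $[x,y]=xy\bar x\bar y$. $\arcsin$ takes values in $[-\frac\pi2,\frac\pi2]$. Pillowcase. $R(S^2,\{m,b,c,n\})$ is the space of conjugacy classes of homomorphisms $\langle m,b,c,n\mid bm=cn\rangle\to SU(2)$ sending each generator into $C(\mathbf i)$. It is identified with $\mathbb{R}^2/\sim$, where $(\gamma,\theta)\sim(-\gamma,-\theta)\sim(\gamma+2\pi k,\theta+2\pi l)$ for $k,l\in\mathbb{Z}$, by letting $(\gamma,\theta)$ correspond to the class of $m\mapsto\mathbf i,\ b\mapsto e^{\gamma\mathbf k}\mathbf i,\ c\mapsto e^{\theta\mathbf k}\mathbf i,\ n\mapsto e^{(\theta-\gamma)\mathbf k}\mathbf i$. Curves are described by lifts to $\mathbb{R}^2$. The images of $(\pi\mathbb{Z})^2$ are the four corner points; an immersion into the pillowcase is a map avoiding the corners that is a smooth immersion into the smooth surface complementary to them. The diagonal arc is the image of $\{(\gamma,\gamma):\gamma\in[0,\pi]\}$. The tangle and the perturbation. $A_1\cup A_2\subset B^3$ is a pair of unknotted arcs in a 3-ball; the boundary meridians are $m,n$ (ends of $A_1$) and $b,c$ (ends of $A_2$). A Hopf link $H_1\cup H$, whose two components are joined by an arc $W$, is placed in the interior of $B^3$ away from the arcs. Two disjoint smaller balls $B^3_1,B^3_2$ lie in $B^3$: $B^3_1$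 contains a piece of $A_2$, a piece of $H_1$ (with end meridians $a,d$), $H$, $W$ and a perturbation circle $P_1$ linking $A_2$ and $H$; $B^3_2$ contains a piece of $A_1$, the other piece of $H_1$, and a perturbation circle $P_2$ linking both. Let $h,w,p_1,p_2$ be meridians of $H,W,P_1,P_2$. The longitude of $P_1$ is $bh$ and the longitude of $P_2$ is $\bar a m$. The fundamental group of the complement of the arcs, Hopf link, $W$, $P_1$ and $P_2$ is generated by $a,b,c,d,h,w,p_1,m,n,p_2$ with relations $$c=\bar p_1bp_1,\ d=\bar cba,\ [bh,p_1]=1,\ [a\bar p_1,h]=(ha)w(\bar a\bar h),\ d=\bar p_2ap_2,\ n=\bar p_2mp_2,\ [\bar am,p_2]=1 .$$ $R^\sharp_\pi(B^3,A_1\cup A_2)$ is the space of conjugacy classes of homomorphisms of this group to $SU(2)$ sending $a,b,c,d,h,m,n$ into $C(\mathbf i)$, sending $w$ to $-1$, and satisfying the perturbation conditions: if $bh\mapsto e^{\beta Q}$ with $Q\in C(\mathbf i)$ then $p_1\mapsto e^{\epsilon\sin(\beta)Q}$; if $\bar am\mapsto e^{\beta'Q'}$ with $Q'\in C(\mathbf i)$ then $p_2\mapsto e^{2\epsilon\sin(\beta')Q'}$. The restriction map restricts a representation to $m,b,c,n$. *)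

(* Defs.v *)
From HB Require Import structures.
From mathcomp Require Import all_boot all_order all_algebra.
From mathcomp Require Import generic_quotient.
From mathcomp Require Import all_classical all_reals all_analysis.
From mathcomp Require Import ring lra.

Set Implicit Arguments.
Unset Strict Implicit.
Unset Printing Implicit Defensive.

Import Order.TTheory GRing.Theory Num.Theory.
Import numFieldNormedType.Exports.

Local Open Scope classical_set_scope.
Local Open Scope quotient_scope.
Local Open Scope ring_scope.

(* (x, y, z, t) stands for x + y i + z j + t k. *)
Definition quat (R : realType) : Type := (R * R * R * R)%type.
HB.instance Definition _ (R : realType) :=
  Topological.copy (quat R) (R * R * R * R)%type.

Section Quaternions.
Variable R : realType.
Implicit Types p q : quat R.

Definition qmk (x y z t : R) : quat R := (x, y, z, t).

Definition qcoord (l : 'I_4) (q : quat R) : R :=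
  let: (x, y, z, t) := q in tnth [tuple x; y; z; t] l.

Definition qre (q : quat R) : R := let: (x, _, _, _) := q in x.

Definition qmul p q : quat R :=
  let: (x, y, z, t) := p in
  let: (x', y', z', t') := q in
  qmk (x * x' - y * y' - z * z' - t * t')
      (x * y' + y * x' + z * t' - t * z')
      (x * z' - y * t' + z * x' + t * y')
      (x * t' + y * z' - z * y' + t * x').

Definition qconj q : quat R := let: (x, y, z, t) := q in qmk x (- y) (- z) (- t).

Definition qnorm2 q : R :=
  let: (x, y, z, t) := q in x ^+ 2 + y ^+ 2 + z ^+ 2 + t ^+ 2.

Lemma qmulA : associative qmul.
Proof.
by move=> [[[? ?] ?] ?] [[[? ?] ?] ?] [[[? ?] ?] ?];
  rewrite /qmul /qmk; congr (_, _, _, _); ring.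
Qed.

Lemma qnorm2M p q : qnorm2 (qmul p q) = qnorm2 p * qnorm2 q.
Proof. by case: p q => [[[? ?] ?] ?] [[[? ?] ?] ?]; rewrite /qnorm2 /=; ring. Qed.

Lemma qnorm2C q : qnorm2 (qconj q) = qnorm2 q.
Proof. by case: q => [[[? ?] ?] ?]; rewrite /qnorm2 /=; ring. Qed.

Lemma qmul1q q : qmul (qmk 1 0 0 0) q = q.
Proof. by case: q => [[[? ?] ?] ?]; rewrite /= /qmk; congr (_, _, _, _); ring. Qed.

Lemma qmulq1 q : qmul q (qmk 1 0 0 0) = q.
Proof. by case: q => [[[? ?] ?] ?]; rewrite /= /qmk; congr (_, _, _, _); ring. Qed.

Lemma qmulVq q : qmul (qconj q) q = qmk (qnorm2 q) 0 0 0.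
Proof.
by case: q => [[[? ?] ?] ?]; rewrite /qnorm2 /= /qmk; congr (_, _, _, _); ring.
Qed.

Lemma qmulqV q : qmul q (qconj q) = qmk (qnorm2 q) 0 0 0.
Proof.
by case: q => [[[? ?] ?] ?]; rewrite /qnorm2 /= /qmk; congr (_, _, _, _); ring.
Qed.

End Quaternions.

(* SU(2), as the unit quaternions, with the subspace topology. *)
Record SU2 (R : realType) := MkSU2 {
  qval : quat R;
  qval_unit : qnorm2 qval == 1
}.
HB.instance Definition _ (R : realType) := [isSub for @qval R].
HB.instance Definition _ (R : realType) := [Choice of SU2 R by <:].
HB.instance Definition _ (R : realType) :=
  Topological.copy (SU2 R) (initial_topology (@qval R)).

Section SU2Group.
Variable R : realType.
Implicit Types p q : SU2 R.

Lemma SU2_norm q : qnorm2 (qval q) = 1.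
Proof. exact/eqP/qval_unit. Qed.

Definition mkSU2 (q : quat R) (hq : qnorm2 q = 1) : SU2 R :=
  MkSU2 (introT eqP hq).

Lemma sone_subproof : qnorm2 (qmk 1 0 0 0 : quat R) = 1.
Proof. by rewrite /qnorm2 /=; ring. Qed.

Lemma sopp1_subproof : qnorm2 (qmk (-1) 0 0 0 : quat R) = 1.
Proof. by rewrite /qnorm2 /=; ring. Qed.

Lemma smul_subproof p q : qnorm2 (qmul (qval p) (qval q)) = 1.
Proof. by rewrite qnorm2M !SU2_norm mulr1. Qed.

Lemma sinv_subproof q : qnorm2 (qconj (qval q)) = 1.
Proof. by rewrite qnorm2C SU2_norm. Qed.

Definition sone : SU2 R := mkSU2 sone_subproof.
Definition sopp1 : SU2 R := mkSU2 sopp1_subproof.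
Definition smul p q : SU2 R := mkSU2 (smul_subproof p q).
Definition sinv q : SU2 R := mkSU2 (sinv_subproof q).

Lemma smulA : associative smul.
Proof. by move=> p q r; apply: val_inj; exact: qmulA. Qed.

Lemma smul1q : left_id sone smul.
Proof. by move=> q; apply: val_inj; exact: qmul1q. Qed.

Lemma smulq1 : right_id sone smul.
Proof. by move=> q; apply: val_inj; exact: qmulq1. Qed.

Lemma smulVq : left_inverse sone sinv smul.
Proof. by move=> q; apply: val_inj; rewrite [LHS]qmulVq SU2_norm. Qed.

Lemma smulqV : right_inverse sone sinv smul.
Proof. by move=> q; apply: val_inj; rewrite [LHS]qmulqV SU2_norm. Qed.

HB.instance Definition _ :=
  isGroup.Build (SU2 R) smulA smul1q smulq1 smulVq smulqV.

End SU2Group.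

(* C(i), the traceless unit quaternions. *)
Definition pureC (R : realType) : set (SU2 R) := [set q | qre (qval q) = 0].
Definition Ci (R : realType) : Type := set_type (@pureC R).

Section Exponential.
Variable R : realType.

Lemma qi_subproof : qnorm2 (qmk 0 1 0 0 : quat R) = 1.
Proof. by rewrite /qnorm2 /=; ring. Qed.

Lemma qk_subproof : qnorm2 (qmk 0 0 0 1 : quat R) = 1.
Proof. by rewrite /qnorm2 /=; ring. Qed.

Definition ii : SU2 R := mkSU2 qi_subproof.

Definition kk : Ci R :=
  SigSub (mem_set (erefl : pureC (mkSU2 qk_subproof))).

(* cos t + sin t Q *)
Definition qexp (t : R) (q : quat R) : quat R :=
  let: (x, y, z, u) := q in
  qmk (cos t + sin t * x) (sin t * y) (sin t * z) (sin t * u).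

Lemma expC_subproof t (Q : Ci R) : qnorm2 (qexp t (qval (set_val Q))) = 1.
Proof.
have := SU2_norm (set_val Q); have : qre (qval (set_val Q)) = 0 by exact: (set_valP Q).
case: (qval (set_val Q)) => [[[x y] z] u]; rewrite /qnorm2 /= => -> h.
have h' : y ^+ 2 + z ^+ 2 + u ^+ 2 = 1 by rewrite -h; ring.
rewrite mulr0 addr0 !exprMn -!addrA -!mulrDr addrA h' mulr1.
exact: cos2Dsin2.
Qed.

Definition expC (t : R) (Q : Ci R) : SU2 R := mkSU2 (expC_subproof t Q).

End Exponential.

Arguments ii {R}.
Arguments kk {R}.
Arguments sopp1 {R}.

(* A homomorphism from a presented group to SU(2) is an assignment of values
   to the generators that satisfies the relations.  For a set X of such
   assignments, [conj_classes X] is the space of conjugacy classes: the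
   subspace topology from SU(2)^G, then the quotient topology. *)
Section ConjugacyClasses.
Local Open Scope group_scope.
Variables (R : realType) (G : Type) (X : set {ptws G -> SU2 R}).

Definition conjugate (r s : set_type X) : Prop :=
  exists g : SU2 R, forall x, set_val s x = g * set_val r x * g^-1.

Definition conjb (r s : set_type X) : bool := `[< conjugate r s >].

Lemma conjb_refl : reflexive conjb.
Proof. by move=> r; apply/asboolP; exists 1 => x; rewrite invg1 mulg1 mul1g. Qed.

Lemma conjb_sym : symmetric conjb.
Proof.
suff sym r s : conjugate r s -> conjugate s r.
  by move=> r s; apply: asbool_equiv_eq; split; exact: sym.
move=> [g rs]; exists g^-1 => x.
by rewrite rs invgK !mulgA mulVg mul1g -mulgA mulVg mulg1.
Qed.

Lemma conjb_trans : transitive conjb.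
Proof.
move=> s r t /asboolP [g rs] /asboolP [g' st]; apply/asboolP.
by exists (g' * g) => x; rewrite st rs invgM !mulgA.
Qed.

Canonical conj_equiv := EquivRel conjb conjb_refl conjb_sym conjb_trans.

Definition conj_classes : Type := quotient_topology {eq_quot conj_equiv}.
HB.instance Definition _ :=
  Topological.copy conj_classes (quotient_topology {eq_quot conj_equiv}).
HB.instance Definition _ :=
  Quotient.copy conj_classes (quotient_topology {eq_quot conj_equiv}).

Definition conj_class (r : set_type X) : conj_classes :=
  \pi_conj_classes r.

Lemma conj_classP (r s : set_type X) :
  conj_class r = conj_class s <-> conjugate r s.
Proof.
split=> [/eqquotP/asboolP //|rs].
by apply/eqquotP; exact/asboolP.
Qed.

End ConjugacyClasses.

Inductive pgen := Pm | Pb | Pc | Pn.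

(* Meridians: m, n of A_1; b, c of A_2; a, d of H_1; h of H; w of the arc W;
   p1, p2 of the perturbation curves P_1, P_2, with longitudes b h and a^-1 m. *)
Inductive tgen := Ga | Gb | Gc | Gd | Gh | Gw | Gp1 | Gm | Gn | Gp2.

HB.instance Definition _ := gen_eqMixin pgen.
HB.instance Definition _ := gen_choiceMixin pgen.
HB.instance Definition _ := gen_eqMixin tgen.
HB.instance Definition _ := gen_choiceMixin tgen.

Section Moduli.
Local Open Scope group_scope.
Variable R : realType.

(* The library's [~ x, y] is x^-1 y^-1 x y. *)
Definition comm_bar (x y : SU2 R) : SU2 R := x * y * x^-1 * y^-1.

Definition pillow_reps : set {ptws pgen -> SU2 R} := [set r |
  let m := r Pm in let b := r Pb in let c := r Pc in let n := r Pn in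
  b * m = c * n /\ [/\ pureC m, pureC b, pureC c & pureC n]].

Definition pillowcase : Type := conj_classes pillow_reps.
HB.instance Definition _ := Topological.copy pillowcase (conj_classes pillow_reps).

Definition tangle_relations (r : {ptws tgen -> SU2 R}) : Prop :=
  let a := r Ga in let b := r Gb in let c := r Gc in let d := r Gd in
  let h := r Gh in let w := r Gw in let p1 := r Gp1 in
  let m := r Gm in let n := r Gn in let p2 := r Gp2 in
  [/\ [/\ c = p1^-1 * b * p1,
          d = c^-1 * b * a,
          comm_bar (b * h) p1 = 1
        & comm_bar (a * p1^-1) h = (h * a) * w * (a^-1 * h^-1)],
      d = p2^-1 * a * p2,
      n = p2^-1 * m * p2
    & comm_bar (a^-1 * m) p2 = 1].

Definition tangle_traceless (r : {ptws tgen -> SU2 R}) : Prop :=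
  [/\ [/\ pureC (r Ga), pureC (r Gb), pureC (r Gc) & pureC (r Gd)],
      pureC (r Gh), pureC (r Gm) & pureC (r Gn)].

Definition perturbed (f : R -> R) (longitude p : SU2 R) : Prop :=
  forall (beta : R) (Q : Ci R),
    longitude = expC beta Q -> p = expC (f beta) Q.

Definition sharp_reps (e : R) : set {ptws tgen -> SU2 R} := [set r |
  [/\ tangle_relations r,
      tangle_traceless r,
      r Gw = sopp1,
      perturbed (fun t => e * sin t)%R (r Gb * r Gh) (r Gp1)
    & perturbed (fun t => 2 * e * sin t)%R ((r Ga)^-1 * r Gm) (r Gp2)]].

Definition Rsharp (e : R) : Type := conj_classes (sharp_reps e).
HB.instance Definition _ e := Topological.copy (Rsharp e) (conj_classes (sharp_reps e)).

Definition to_tgen (x : pgen) : tgen :=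
  match x with Pm => Gm | Pb => Gb | Pc => Gc | Pn => Gn end.

Lemma boundary_relation (a b c d m n p : SU2 R) :
  d = c^-1 * b * a -> d = p^-1 * a * p -> n = p^-1 * m * p ->
  comm_bar (a^-1 * m) p = 1 -> b * m = c * n.
Proof.
move=> -> Ed -> Ec.
have cm : a^-1 * m * p = p * (a^-1 * m).
  by apply: (mulIg (a^-1 * m)^-1); apply: (mulIg p^-1); rewrite -[p * _ / _]mulgA !mulgV mulg1 mulgV.
have -> : b = c * (p^-1 * a * p) * a^-1.
  by rewrite -Ed !mulgA mulgV mul1g -mulgA mulgV mulg1.
rewrite -!mulgA; congr (_ * (_ * _)).
by rewrite -cm !mulgA mulgV mul1g.
Qed.

Lemma restrict_subproof e (r : set_type (sharp_reps e)) :
  pillow_reps (set_val r \o to_tgen).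
Proof.
have [[[_ Ed _ _] Ed' En Ec] [[_ Hb Hc _] _ Hm Hn] _ _ _] := set_valP r.
by split=> //; exact: boundary_relation Ed Ed' En Ec.
Qed.

Definition restrict_rep e (r : set_type (sharp_reps e)) : set_type pillow_reps :=
  SigSub (mem_set (restrict_subproof r)).

(* Independent of the representative, see restrictionE. *)
Definition restriction e (x : Rsharp e) : pillowcase :=
  conj_class (restrict_rep (repr (x : conj_classes (sharp_reps e)))).

Lemma restrictionE e (r : set_type (sharp_reps e)) :
  restriction (conj_class r : Rsharp e) = conj_class (restrict_rep r).
Proof.
apply/conj_classP.
have /conj_classP [g rg] : conj_class (repr (conj_class r)) = conj_class r.
  by rewrite /conj_class reprK.
by exists g => x /=; rewrite -rg.
Qed.

Definition pillow_assign (z : R * R) (x : pgen) : SU2 R :=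
  match x with
  | Pm => ii
  | Pb => expC z.1 kk * ii
  | Pc => expC z.2 kk * ii
  | Pn => expC (z.2 - z.1)%R kk * ii
  end.

Lemma pillow_assign_subproof z : pillow_reps (pillow_assign z).
Proof.
split; last by split; rewrite /pureC /=; ring.
apply: val_inj; rewrite /= cosB sinB /qmk; congr (_, _, _, _); try ring.
- transitivity (- (cos z.1 * (cos z.2 ^+ 2 + sin z.2 ^+ 2)))%R; last by ring.
  by rewrite cos2Dsin2; ring.
- transitivity (- (sin z.1 * (cos z.2 ^+ 2 + sin z.2 ^+ 2)))%R; last by ring.
  by rewrite cos2Dsin2; ring.
Qed.

(* The point of the pillowcase with lift z = (gamma, theta) in R^2. *)
Definition pillow_pt (z : R * R) : pillowcase :=
  conj_class (SigSub (mem_set (pillow_assign_subproof z)) : set_type pillow_reps).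

Definition pillow_corners : set pillowcase :=
  [set P | exists k l : int, P = pillow_pt (k%:~R * pi, l%:~R * pi)%R].

Definition diagonal_arc : set pillowcase :=
  [set pillow_pt (g, g) | g in `[0%R, pi]].

End Moduli.

Section Circle.
Variable R : realType.

Definition circle_rel (x y : R) : bool :=
  `[< exists k : int, y = x + k%:~R * (2 * pi) >].

Lemma circle_refl : reflexive circle_rel.
Proof. by move=> x; apply/asboolP; exists 0; rewrite mul0r addr0. Qed.

Lemma circle_sym : symmetric circle_rel.
Proof.
suff sym x y : circle_rel x y -> circle_rel y x.
  by move=> x y; apply/idP/idP; exact: sym.
by move=> /asboolP [k ->]; apply/asboolP; exists (- k); rewrite mulrNz; ring.
Qed.

Lemma circle_trans : transitive circle_rel.
Proof.
move=> y x z /asboolP [k ->] /asboolP [l ->]; apply/asboolP.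
by exists (k + l); rewrite intrD; ring.
Qed.

Canonical circle_equiv := EquivRel circle_rel circle_refl circle_sym circle_trans.

Definition circle : Type := quotient_topology {eq_quot circle_equiv}.
HB.instance Definition _ :=
  Topological.copy circle (quotient_topology {eq_quot circle_equiv}).
HB.instance Definition _ :=
  Quotient.copy circle (quotient_topology {eq_quot circle_equiv}).

Definition circle_pt (t : R) : circle := \pi_circle t.

End Circle.

Definition homeomorphism (X Y : topologicalType) (f : X -> Y) : Prop :=
  continuous f /\
  exists g : Y -> X, [/\ continuous g, cancel f g & cancel g f].

Definition generically_to_one (n : nat) (X Y : Type) (f : X -> Y) (D : set Y)
    : Prop :=
  finite_set [set y | D y /\ ~ (f @^-1` [set y] #= `I_n)%card].

Section Smoothness.
Variable R : realType.

Definition smooth (f : R -> R) : Prop :=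
  forall (n : nat) (t : R), derivable (derive1n n f) t 1.

(* [bool * circle R] is the disjoint union of two circles.  A parametrization
   of the moduli space is smooth when it lifts locally to smooth families of
   representations.  If in addition it is a homeomorphism and its composite
   with [restriction] is an immersion, then the velocity of such a lift is
   nowhere tangent to the conjugation orbit, i.e. the parametrization is a
   diffeomorphism for the smooth structure induced from SU(2)^10.  Requiring
   the lift to be defined on all of R is no restriction, as the parameter may
   be composed with a smooth map that is the identity near t0. *)
Definition smooth_parametrization (e : R)
    (Phi : bool * circle R -> Rsharp e) : Prop :=
  forall (i : bool) (t0 : R), exists r : R -> set_type (sharp_reps e),
    (forall x l, smooth (fun t => qcoord l (qval (set_val (r t) x)))) /\
    \forall t \near t0, Phi (i, circle_pt t) = conj_class (r t).

(* Away from the corners R^2 -> pillowcase is a covering, and it defines the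
   smooth structure there. *)
Definition pillow_immersed (f : R -> pillowcase R) : Prop :=
  forall t0 : R, ~ pillow_corners (f t0) /\
    exists g1 g2 : R -> R,
      [/\ smooth g1, smooth g2,
          \forall t \near t0, f t = pillow_pt (g1 t, g2 t)
        & ~ (derive1 g1 t0 = 0 /\ derive1 g2 t0 = 0)].

(* f is an immersion in the coordinates Phi. *)
Definition immersion_along (X : Type) (Phi : bool * circle R -> X)
    (f : X -> pillowcase R) : Prop :=
  forall i : bool, pillow_immersed (fun t => f (Phi (i, circle_pt t))).

End Smoothness.

Section Curves.
Variable R : realType.

(* The index i = 1, 2 is encoded as false, true. *)
Definition tau (i : bool) (beta : R) : R :=
  let tau1 := asin (- (1 / 2) * sin beta) in if i then pi - tau1 else tau1.

Definition rho (e : R) (i : bool) (beta : R) : R * R :=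
  (- tau i beta + pi / 2 + beta + e * sin beta,
   - tau i beta + pi / 2 + beta - e * sin beta).

End Curves.

(* Main.v *)
Require Import Defs.
From mathcomp Require Import all_boot all_order all_algebra.
From mathcomp Require Import generic_quotient.
From mathcomp Require Import all_classical all_reals all_analysis.
From mathcomp Require Import ring lra.

(* Write E t = e^{t k}.  Conjugate a representation so that h = i and
   a p1^-1 = j; the latter is possible because [a p1^-1, h] = -1 says that
   a p1^-1 is traceless and orthogonal to h.  Tracelessness of a = j p1 then
   forces b h = E beta, so p1 = E (e sin beta), and a, b, c, d all lie on the
   circle {E t i}.  For small e, the conjugation d = p2^-1 a p2 forces
   a^-1 m = E beta' with sin beta' = (sin beta) / 2, and the two solutions
   beta' = - tau_i beta give the two circles.

   The functions Re (b h), Re (b a p1^-1), Re (a^-1 m) are invariant under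
   conjugation and equal cos beta, sin beta, cos (tau_i beta) on the normal
   form; they separate the points of the compact space of parameters, so the
   parametrization is a homeomorphism.

   At e = 0 the lift - tau_i beta + pi/2 + beta is a bijection of R commuting
   with translation by 2 pi.  Each component therefore covers a point of the
   open diagonal arc twice, once for each of the lifts g and - g. *)

Set Implicit Arguments.
Unset Strict Implicit.
Unset Printing Implicit Defensive.

Import Order.TTheory GRing.Theory Num.Theory.
Import numFieldNormedType.Exports.

Local Open Scope classical_set_scope.
Local Open Scope ring_scope.

(** * Smoothness and trigonometry *)

Section Trigonometry.
Variable R : realType.
Implicit Types (s t x y : R) (k : int).

Lemma cosD2piz t k : cos (t + k%:~R * (2 * pi)) = cos t.
Proof.
have nat_case u n : cos (u + n%:R * (2 * pi)) = cos u :> R.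
  rewrite -[RHS](periodicn (@cosD2pi R) n); congr (cos (_ + _)).
  by rewrite -[pi *+ 2 *+ n]mulr_natl -[pi *+ 2]mulr_natl.
case: k => n; first exact: nat_case.
by rewrite NegzE -[LHS](nat_case _ n.+1) mulrNz mulNr subrK.
Qed.

Lemma sinD2piz t k : sin (t + k%:~R * (2 * pi)) = sin t.
Proof. by rewrite -[LHS]cosBpihalf addrAC cosD2piz cosBpihalf. Qed.

(** Half the remainder of [t - s] modulo [2 * pi] is an angle [u] in [0, pi) with cos (2 u) = 1.
    Hence sin u = 0, and so u = 0. *)
Lemma cos_sin_inj s t : cos s = cos t -> sin s = sin t ->
  exists k, t = s + k%:~R * (2 * pi).
Proof.
move=> cE sE; exists (Num.floor ((t - s) / (2 * pi))).
have pi2 : 0 < 2 * pi :> R by rewrite mulr_gt0 ?pi_gt0.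
set k := Num.floor _; set u := (t - s - k%:~R * (2 * pi)) / 2.
have tE : t - s = 2 * u + k%:~R * (2 * pi) by rewrite /u; field.
have u0 : 0 <= u.
  rewrite divr_ge0// subr_ge0 -ler_pdivlMr//; exact: ge_floor.
have upi : u < pi.
  have : t - s < (k + 1)%:~R * (2 * pi).
    by rewrite -ltr_pdivrMr//; exact: lt_succ_floor.
  by rewrite intrD /u; lra.
have cu : cos (t - s) = 1 by rewrite cosB cE sE -!expr2 cos2Dsin2.
have su : sin u = 0.
  move: cu; rewrite tE cosD2piz mulr_natl cos_mulr2n cos2sin2 => h.
  by apply/eqP; rewrite -sqrf_eq0; apply/eqP; move: h; rewrite mulr2n; lra.
have [u_eq0|u_neq0] := eqVneq u 0; first by move: tE; rewrite u_eq0; lra.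
have : 0 < sin u by apply: sin_gt0_pi; rewrite lt_neqAle eq_sym u_neq0 u0.
by rewrite su ltxx.
Qed.

(** [acos x] has the right cosine and, up to sign, the right sine; negating the angle corrects the
    sign. *)
Lemma unit_angle x y : x ^+ 2 + y ^+ 2 = 1 -> exists t, x = cos t /\ y = sin t.
Proof.
move=> xy; have x1 : -1 <= x <= 1.
  by have y2 := sqr_ge0 y; apply/andP; split; nra.
have sE : sin (acos x) ^+ 2 = y ^+ 2.
  by rewrite sin2cos2 acosK ?in_itv//=; lra.
have /orP[/eqP sy|/eqP sy] : (sin (acos x) == y) || (sin (acos x) == - y).
  by rewrite -eqf_sqr sE.
- by exists (acos x); rewrite acosK ?in_itv.
- by exists (- acos x); rewrite cosN sinN sy opprK acosK ?in_itv.
Qed.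

Lemma sinz_pi k : sin (k%:~R * pi) = 0 :> R.
Proof.
apply/eqP; rewrite -sqrf_eq0; apply/eqP.
have := cos_mulr2n (k%:~R * pi : R); rewrite cos2sin2.
rewrite (_ : k%:~R * pi *+ 2 = 0 + k%:~R * (2 * pi)); last by rewrite mulr2n; ring.
by rewrite cosD2piz cos0 mulr2n; lra.
Qed.

End Trigonometry.

(** * Elementary functions of one real variable *)

Section ElementaryFunctions.
Variable R : realType.
Implicit Types f g : R -> R.

(* Closed under differentiation, so that membership implies smoothness. *)
Inductive elementary : (R -> R) -> Prop :=
| elementary_cst c : elementary (fun=> c)
| elementary_id : elementary id
| elementaryD f g : elementary f -> elementary g -> elementary (fun t => f t + g t)
| elementaryM f g : elementary f -> elementary g -> elementary (fun t => f t * g t)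
| elementaryV f : elementary f -> (forall t, f t != 0) -> elementary (fun t => (f t)^-1)
| elementary_sin f : elementary f -> elementary (fun t => sin (f t))
| elementary_cos f : elementary f -> elementary (fun t => cos (f t))
| elementary_asin f : elementary f -> (forall t, -1 < f t < 1) ->
    elementary (fun t => asin (f t)).

Lemma elementaryN f : elementary f -> elementary (fun t => - f t).
Proof.
move=> ef; have -> : (fun t => - f t) = fun t => (-1) * f t.
  by apply/funext => t; rewrite mulN1r.
by apply: elementaryM ef; exact: elementary_cst.
Qed.

Lemma elementary_derive f : elementary f ->
  exists2 g, elementary g & forall t : R, is_derive t (1 : R) f (g t).
Proof.
elim=> {f}.
- move=> c; exists (fun=> 0) => [|t]; first exact: elementary_cst.
  exact: is_derive_cst.
- exists (fun=> 1) => [|t]; first exact: elementary_cst.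
  exact: is_derive_id.
- move=> f g _ [f' ef' df] _ [g' eg' dg]; exists (fun t => f' t + g' t).
    exact: elementaryD.
  by move=> t; exact: is_deriveD.
- move=> f g ef [f' ef' df] eg [g' eg' dg].
  exists (fun t => f t * g' t + g t * f' t).
    by apply: elementaryD; exact: elementaryM.
  by move=> t; exact: is_deriveM.
- move=> f ef [f' ef' df] limit_map.
  exists (fun t => - ((f t)^-1 * (f t)^-1 * f' t)).
    by apply/elementaryN/elementaryM => //; apply: elementaryM; exact: elementaryV.
  move=> t; have := is_deriveV (limit_map t) (df t).
  by move=> h; apply: is_derive_eq h _; rewrite -mulNr -exprVn -expr2.
- move=> f ef [f' ef' df]; exists (fun t => cos (f t) * f' t).
    by apply: elementaryM => //; exact: elementary_cos.
  by move=> t; exact: (@is_derive1_comp _ sin f).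
- move=> f ef [f' ef' df]; exists (fun t => - sin (f t) * f' t).
    by apply: elementaryM => //; apply/elementaryN; exact: elementary_sin.
  by move=> t; exact: (@is_derive1_comp _ cos f).
- move=> f ef [f' ef' df] f1.
  have f1' t : -1 <= f t <= 1 by have /andP[/ltW -> /ltW ->] := f1 t.
  (* The factor 1 / sqrt (1 - f^2) is written as 1 / cos (asin f), because square roots are not
     among the constructors of [elementary]. *)
  exists (fun t => (cos (asin (f t)))^-1 * f' t).
    apply: elementaryM => //; apply: elementaryV => [|t].
      by apply: elementary_cos; exact: elementary_asin.
    have /andP[fN1 fP1] := f1 t; rewrite gt_eqF// cos_gt0_pihalf//.
    by rewrite asin_gtNpi2 ?asin_ltpi2 ?fN1 ?fP1 ?ltW.
  move=> t; rewrite cos_asin//.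
  have ? := is_derive1_asin (f1 t).
  exact: (@is_derive1_comp _ asin f).
Qed.

Lemma elementary_smooth f : elementary f -> smooth f.
Proof.
move=> ef n t; suff : elementary (derive1n n f).
  by move=> /elementary_derive[g _ dg]; case: (dg t).
elim: {t} n => [//|n /elementary_derive[g eg dg]].
rewrite derive1nS (_ : derive1 _ = g)//.
by apply/funext => x; rewrite derive1E; case: (dg x).
Qed.

Lemma elementary_continuous f : elementary f -> continuous f.
Proof.
move=> /elementary_derive[g _ dg] t.
by apply: differentiable_continuous; apply/derivable1_diffP; case: (dg t).
Qed.

End ElementaryFunctions.

(** * Unit quaternions *)

Section UnitQuaternions.
Variable R : realType.
Implicit Types (s t : R) (p q g : SU2 R) (P Q : Ci R).

Local Notation E t := (expC t kk).
Local Notation D t := (expC t kk * ii)%g.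

Lemma qvalM p q : qval (p * q)%g = qmul (qval p) (qval q).
Proof. by []. Qed.

Lemma Ci_coords Q : exists u : R * R * R,
  qval (set_val Q) = (0, u.1.1, u.1.2, u.2) /\
  u.1.1 ^+ 2 + u.1.2 ^+ 2 + u.2 ^+ 2 = 1.
Proof.
have := SU2_norm (set_val Q); have : qre (qval (set_val Q)) = 0 by exact: (set_valP Q).
case: (qval _) => [[[x y] z] w] /= ->; rewrite /qnorm2 => <-.
by exists (y, z, w); split=> //=; ring.
Qed.

Lemma Ci_of_vec (y z w : R) : y ^+ 2 + z ^+ 2 + w ^+ 2 = 1 ->
  exists Q : Ci R, qval (set_val Q) = (0, y, z, w).
Proof.
move=> yzw; have n1 : qnorm2 (0, y, z, w) = 1 by rewrite -yzw /qnorm2; ring.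
by exists (SigSub (mem_set (erefl : pureC (mkSU2 n1)))).
Qed.

Lemma expCE t (x y z : R) Q : qval (set_val Q) = (0, x, y, z) ->
  qval (expC t Q) = (cos t, sin t * x, sin t * y, sin t * z).
Proof. by move=> QE; rewrite /= QE /= /qmk mulr0 addr0. Qed.

(** The axis is the normalized imaginary part of [q]; when that part vanishes every axis serves, and
    [kk] is taken. *)
Lemma polar_form q : exists t Q, q = expC t Q.
Proof.
have := SU2_norm q; case qE : (qval q) => [[[x y] z] w]; rewrite /qnorm2 => n1.
set v := y ^+ 2 + z ^+ 2 + w ^+ 2.
have v_ge0 : 0 <= v by rewrite !addr_ge0 ?sqr_ge0.
have [v0|v0] := eqVneq v 0.
  have [t [xt st]] : exists t, x = cos t /\ 0 = sin t.
    by apply: unit_angle; rewrite -n1; move: v0; rewrite /v; lra.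
  exists t, kk; apply: val_inj; rewrite /= qE /qmk -xt -st.
  by congr (_, _, _, _); rewrite /v in v0; nra.
have vs : Num.sqrt v != 0 by rewrite gt_eqF// sqrtr_gt0 lt_neqAle eq_sym v0.
have [t [xt st]] : exists t, x = cos t /\ Num.sqrt v = sin t.
  by apply: unit_angle; rewrite sqr_sqrtr// -n1 /v; ring.
have [Q QE] : exists Q : Ci R, qval (set_val Q) =
    (0, y / Num.sqrt v, z / Num.sqrt v, w / Num.sqrt v).
  by apply: Ci_of_vec; rewrite !expr_div_n -!mulrDl -/v sqr_sqrtr// divff.
exists t, Q; apply: val_inj; rewrite [RHS](expCE _ QE) [LHS]qE -st -xt.
by congr (_, _, _, _); field.
Qed.

(* Replacing (t, Q) by (- t, - Q) does not change [expC t Q], and [sin] is odd. *)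
Lemma expC_sin_eq c s t P Q : expC s P = expC t Q ->
  expC (c * sin s) P = expC (c * sin t) Q.
Proof.
have [[[x y] z] [PE /= n1]] := Ci_coords P.
have [[[x' y'] z'] [QE /= n2]] := Ci_coords Q.
move=> /(congr1 (@qval R)); rewrite (expCE _ PE) (expCE _ QE) => -[_ hx hy hz].
have hh : (sin s) ^+ 2 = (sin t) ^+ 2.
  rewrite -[LHS]mulr1 -[RHS]mulr1 -{1}n1 -n2 !mulrDr -!exprMn.
  by rewrite hx hy hz.
apply: val_inj; rewrite [LHS](expCE _ PE) [RHS](expCE _ QE).
(* If sin s = 0 the axes [P] and [Q] are unrelated, but sin t = 0 as well and both sides are 1. *)
have [s0|s0] := eqVneq (sin s) 0.
  move: hh; rewrite s0 expr0n /= => /esym/eqP; rewrite sqrf_eq0 => /eqP ->.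
  by rewrite mulr0 sin0 !mul0r.
have /orP[/eqP st|/eqP st] : (sin s == sin t) || (sin s == - sin t).
- by rewrite -eqf_sqr hh.
- by rewrite -st in hx hy hz *; rewrite (mulfI s0 hx) (mulfI s0 hy) (mulfI s0 hz).
- have tE : sin t = - sin s by rewrite st opprK.
  move: hx hy hz; rewrite tE !mulNr -!mulrN.
  move=> /(mulfI s0) -> /(mulfI s0) -> /(mulfI s0) ->.
  by rewrite !mulrN sinN cosN !mulNr.
Qed.

Lemma expCD s t Q : (expC s Q * expC t Q)%g = expC (s + t) Q.
Proof.
have [[[x y] z] [QE /= n1]] := Ci_coords Q.
apply: val_inj; rewrite [RHS](expCE _ QE) /= QE /= /qmk sinD cosD.
congr (_, _, _, _); try ring.
by rewrite -[sin s * sin t]mulr1 -n1; ring.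
Qed.

Lemma expC0 Q : expC 0 Q = 1%g.
Proof.
have [[[x y] z] [QE /= n1]] := Ci_coords Q.
by apply: val_inj; rewrite [LHS](expCE _ QE) sin0 cos0 !mul0r.
Qed.

Lemma expCV t Q : ((expC t Q)^-1)%g = expC (- t) Q.
Proof. by apply: mulg1_eq; rewrite expCD subrr expC0. Qed.

Lemma expC2pi t Q : expC (t + 2 * pi) Q = expC t Q.
Proof.
have [[[x y] z] [QE _]] := Ci_coords Q.
apply: val_inj; rewrite [LHS](expCE _ QE) [RHS](expCE _ QE).
have := cosD2piz t 1; have := sinD2piz t 1.
by rewrite mulr1z mul1r => -> ->.
Qed.

(** * Multiplication on the circle of the [E t] and its coset, the [D t] *)

Lemma Eval t : qval (E t) = (cos t, 0, 0, sin t).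
Proof. by rewrite /= /qmk !mulr0 mulr1 addr0. Qed.

Lemma Dval t : qval (D t) = (0, cos t, sin t, 0).
Proof. by rewrite /= /qmk; congr (_, _, _, _); ring. Qed.

Lemma pureD t : pureC (D t).
Proof. by have := Dval t; rewrite /pureC /= /qmk => -[->]. Qed.

Lemma mulED s t : (E s * D t)%g = D (s + t).
Proof. by rewrite mulgA expCD. Qed.

(** Since i e^{tk} = e^{-tk} i, an angle changes sign when it passes [ii]. *)
Lemma mulDE s t : (D s * E t)%g = D (s - t).
Proof.
apply: val_inj; rewrite [RHS]Dval [LHS]/=.
by rewrite cosB sinB /qmk; congr (_, _, _, _); ring.
Qed.

(** The two factors i combine to i^2 = -1, which is the shift by [pi]. *)
Lemma mulDD s t : (D s * D t)%g = E (s - t + pi).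
Proof.
apply: val_inj; rewrite [RHS]Eval [LHS]/=.
by rewrite cosDpi sinDpi cosB sinB /qmk; congr (_, _, _, _); ring.
Qed.

Lemma invD t : ((D t)^-1)%g = D (t + pi).
Proof.
by apply: mulg1_eq; rewrite mulDD (_ : t - (t + pi) + pi = 0) ?expC0//; ring.
Qed.

Lemma E_pi : E (pi : R) = sopp1.
Proof. by apply: val_inj; rewrite [LHS]Eval cospi sinpi. Qed.

Lemma E_inj s t : E s = E t -> cos s = cos t /\ sin s = sin t.
Proof. by move=> /(congr1 (@qval R)); rewrite !Eval => -[]. Qed.

Lemma E_eq_cos_sin s t : cos s = cos t -> sin s = sin t -> E s = E t.
Proof. by move=> cst sst; apply: val_inj; rewrite [LHS]Eval [RHS]Eval cst sst. Qed.

Lemma qre_conj g q : qre (qval (g * q * g^-1)%g) = qre (qval q).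
Proof.
have := SU2_norm g; rewrite /=; case: (qval g) (qval q) => [[[? ?] ?] ?] [[[x ?] ?] ?].
by rewrite /qnorm2 /= => h; rewrite -[RHS]mulr1 -h; ring.
Qed.

(** Conjugation is linear and fixes the reals, so it acts on cos t + sin t Q through [Q] alone. *)
Lemma expC_conj g Q : exists2 P : Ci R,
  (set_val P = g * set_val Q * g^-1)%g & forall t, expC t P = (g * expC t Q * g^-1)%g.
Proof.
have pP : pureC (g * set_val Q * g^-1)%g by rewrite /pureC /= qre_conj (set_valP Q).
exists (SigSub (mem_set pP)) => // s; apply: val_inj.
transitivity (qexp s (qmul (qmul (qval g) (qval (set_val Q))) (qconj (qval g)))) => //.
have [[[x y] z] [QE /= n1]] := Ci_coords Q.
have := SU2_norm g; rewrite [in RHS]/= QE; case: (qval g) => [[[a b] c] d].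
rewrite /qnorm2 /= /qmk => h; congr (_, _, _, _); try ring.
transitivity (cos s * (a ^+ 2 + b ^+ 2 + c ^+ 2 + d ^+ 2)); last by ring.
by rewrite h; ring.
Qed.

(** Serves for conjugators known only up to scale: the equations to be checked are linear in [g], so
    the factor [c] does no harm. *)
Lemma normalize (x y z w : R) : (x, y, z, w) != (0, 0, 0, 0) ->
  exists g, exists2 c : R, c != 0 & qval g = (c * x, c * y, c * z, c * w).
Proof.
move=> xyzw; set v := x ^+ 2 + y ^+ 2 + z ^+ 2 + w ^+ 2.
have v_gt0 : 0 < v.
  have v_ge0 : 0 <= v by rewrite !addr_ge0 ?sqr_ge0.
  rewrite lt_neqAle v_ge0 andbT; apply: contra xyzw => /eqP/esym/eqP.
  by rewrite !paddr_eq0 ?addr_ge0 ?sqr_ge0// !sqrf_eq0 => /andP[/andP[/andP[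
    /eqP -> /eqP ->] /eqP ->] /eqP ->].
have n1 : qnorm2 ((Num.sqrt v)^-1 * x, (Num.sqrt v)^-1 * y,
    (Num.sqrt v)^-1 * z, (Num.sqrt v)^-1 * w) = 1.
  by rewrite /qnorm2 !exprMn -!mulrDr -/v exprVn sqr_sqrtr ?ltW// mulVf// gt_eqF.
by exists (mkSU2 n1), (Num.sqrt v)^-1; rewrite ?invr_eq0 ?gt_eqF ?sqrtr_gt0.
Qed.

Lemma pure_coords q : pureC q -> exists u : R * R * R,
  qval q = (0, u.1.1, u.1.2, u.2) /\
  u.1.1 ^+ 2 + u.1.2 ^+ 2 + u.2 ^+ 2 = 1.
Proof. by move=> pq; exact: (Ci_coords (SigSub (mem_set pq))). Qed.

(* Up to normalization, 1 - i q conjugates q to i; it vanishes only if q = - i. *)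
Lemma conj_pure_ii q : pureC q -> exists g, (g * q * g^-1)%g = ii.
Proof.
move=> /pure_coords[[[x y] z] [/= qE n1]].
suff [g gq] : exists g, (g * q)%g = (ii * g)%g.
  by exists g; rewrite gq -mulgA mulgV mulg1.
have [x1|x1] := eqVneq x (-1).
  have [y0 z0] : y = 0 /\ z = 0.
    have := sqr_ge0 y; have := sqr_ge0 z; rewrite x1 in n1; split; nra.
  (* In the exceptional case q = -i, conjugation by k changes the sign of i. *)
  exists (set_val kk); apply: val_inj; rewrite /= qE x1 y0 z0 /= /qmk.
  by congr (_, _, _, _); ring.
have [|g [c c0 gE]] := @normalize (1 + x) 0 z (- y).
  by apply: contra_neq x1 => -[]; lra.
exists g; apply: val_inj; rewrite /= qE gE /= /qmk.
have x2 : x ^+ 2 = 1 - y ^+ 2 - z ^+ 2 by rewrite -n1; ring.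
by congr (_, _, _, _); ring: x2.
Qed.

(** The quaternion j, written as a point of the circle [D] so that the multiplication rules for
    angles apply to it. *)
Definition jj : SU2 R := D ((pi : R) / 2).

Lemma jj_val : qval jj = (0, 0, 1, 0).
Proof. by rewrite Dval cos_pihalf sin_pihalf. Qed.

Lemma sopp1C p : (sopp1 * p)%g = (p * sopp1)%g.
Proof.
by apply: val_inj => /=; case: (qval p) => [[[? ?] ?] ?] /=; rewrite /qmk;
  congr (_, _, _, _); ring.
Qed.

(** The commutator condition says that [p] and [q] anticommute. Once [q] is moved to i, the image of
    [p] is a pure unit orthogonal to i, and a rotation about i brings it to j. *)
Lemma conj_frame p q : pureC p -> pureC q -> comm_bar p q = sopp1 ->
  exists g, (g * q * g^-1)%g = ii /\ (g * p * g^-1)%g = jj.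
Proof.
move=> pp /conj_pure_ii[g0 g0q] pq.
set p' := (g0 * p * g0^-1)%g.
have p'i : (p' * ii)%g = (sopp1 * (ii * p'))%g.
  have pqE : (p * q = sopp1 * q * p)%g by rewrite -pq /comm_bar !mulgVK.
  have -> : (p' * ii = g0 * (p * q) * g0^-1)%g.
    by rewrite -g0q /p' !mulgA mulgVK.
  rewrite pqE -g0q /p' !mulgA mulgVK.
  by rewrite -sopp1C.
suff [g [gi gp]] : exists g, (g * ii = ii * g /\ g * p' = jj * g)%g.
  exists (g * g0)%g; split.
    have -> : (g * g0 * q * (g * g0)^-1 = g * (g0 * q * g0^-1) * g^-1)%g.
      by rewrite invgM !mulgA.
    by rewrite g0q gi mulgK.
  have -> : (g * g0 * p * (g * g0)^-1 = g * p' * g^-1)%g.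
    by rewrite invgM /p' !mulgA.
  by rewrite gp mulgK.
have pp' : pureC p' by rewrite /pureC /p' /= qre_conj.
clearbody p'; have [[[x y] z] [/= pE n1]] := pure_coords pp'.
have x0 : x = 0.
  by move: p'i => /(congr1 (@qval R)); rewrite /= pE /= /qmk => -[]; lra.
rewrite x0 in pE n1.
have [y1|y1] := eqVneq y (-1).
  have z0 : z = 0 by have := sqr_ge0 z; rewrite y1 in n1; nra.
  (* Here p' = -j, which i conjugates to j. *)
  exists ii; split=> //; apply: val_inj.
  rewrite [LHS]qvalM [RHS]qvalM jj_val pE y1 z0 /= /qmk.
  by congr (_, _, _, _); ring.
(* This vector is 1 - j p', which intertwines p' with j and, lying in the span of 1 and i, commutes
   with i. *)
have [|g [c c0 gE]] := @normalize (1 + y) (- z) 0 0.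
  by apply: contra_neq y1 => -[]; lra.
exists g; split; apply: val_inj.
  by rewrite /= gE /= /qmk; congr (_, _, _, _); ring.
rewrite [LHS]qvalM [RHS]qvalM jj_val gE pE /= /qmk.
have y2 : y ^+ 2 = 1 - z ^+ 2 by rewrite -n1; ring.
by congr (_, _, _, _); ring: y2.
Qed.

End UnitQuaternions.

(** * The normal form *)

Section NormalForm.
Variable R : realType.
Implicit Types (s t e beta : R) (g p q : SU2 R) (P Q : Ci R) (i : bool).

Local Notation E t := (expC t kk).
Local Notation D t := (expC t kk * ii)%g.

Lemma half_sin_itv beta : -1 < - (1 / 2) * sin beta < 1.
Proof.
by have := sin_geN1 beta; have := sin_le1 beta; move=> *; apply/andP; split; lra.
Qed.

Lemma sin_tau i beta : sin (tau i beta) = - (1 / 2) * sin beta.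
Proof.
have /andP[/ltW h1 /ltW h2] := half_sin_itv beta.
have h : sin (tau false beta) = - (1 / 2) * sin beta by rewrite /tau asinK// in_itv/= h1.
by case: i => //; rewrite -[RHS]h /tau sinB sinpi cospi mul0r mulN1r sub0r opprK.
Qed.

Lemma cos_tau_gt0 beta : 0 < cos (tau false beta).
Proof.
have /andP[h1 h2] := half_sin_itv beta.
by apply: cos_gt0_pihalf; rewrite asin_gtNpi2 ?asin_ltpi2 ?h1 ?h2 ?ltW.
Qed.

Lemma cos_tau_true beta : cos (tau true beta) = - cos (tau false beta).
Proof. by rewrite /tau cosB sinpi cospi mul0r mulN1r addr0. Qed.

(** The sine determines the cosine up to sign, and the two signs are realized by [tau false] and
    [tau true]. *)
Lemma tau_angle beta t : sin t = 1 / 2 * sin beta ->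
  exists i, cos t = cos (- tau i beta) /\ sin t = sin (- tau i beta).
Proof.
move=> st.
have /orP[/eqP h|/eqP h] : (cos t == cos (tau false beta)) || (cos t == - cos (tau false beta)).
- by rewrite -eqf_sqr !cos2sin2 st sin_tau; apply/eqP; ring.
- by exists false; rewrite cosN sinN sin_tau st h; split=> //; ring.
- by exists true; rewrite cosN sinN sin_tau st h cos_tau_true; split=> //; ring.
Qed.

(** The angle of b h is [beta] and that of a^-1 m is [- tau i beta], modulo 2 pi. Since the latter
    has sine (sin beta) / 2, the coefficient 2 e on P_2 gives p2 the same angle [s] as p1. *)
Definition model e i beta (x : tgen) : SU2 R :=
  let s := e * sin beta in
  match x with
  | Gh => D 0
  | Gb => D (beta + pi)
  | Gc => D (beta + pi - 2 * s)
  | Ga => D (pi / 2 - s)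
  | Gd => D (pi / 2 - 3 * s)
  | Gm => D (pi / 2 - s + tau i beta)
  | Gn => D (pi / 2 - 3 * s + tau i beta)
  | Gp1 | Gp2 => E s
  | Gw => sopp1
  end.

Lemma E2pi s t : s = t + 2 * pi -> E s = E t.
Proof. by move=> ->; exact: expC2pi. Qed.

Lemma E_congr s t : s = t -> E s = E t.
Proof. by move->. Qed.

Lemma D_congr s t : s = t -> D s = D t.
Proof. by move->. Qed.

Lemma modelP e i beta : sharp_reps e (model e i beta).
Proof.
split.
- split; [split|..]; rewrite /comm_bar /= -?E_pi ?(invD, expCV, mulED, mulDE, mulDD, expCD).
  + by apply: D_congr; ring.
  + by congr (_ * _)%g; apply/esym/E2pi; ring.
  + by rewrite -(expC0 kk); apply: E_congr; ring.
  + by apply: E_congr; field.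
  + by apply: D_congr; ring.
  + by apply: D_congr; ring.
  + by rewrite -(expC0 kk); apply: E_congr; ring.
- by split; [split|..]; exact: pureD.
- by [].
(* The condition ranges over all polar forms of the longitude, not only the one with axis k;
   [expC_sin_eq] compares them. *)
- move=> b Q; rewrite /= mulDD.
  rewrite (E2pi (_ : _ = beta + 2 * pi)); last by ring.
  exact: expC_sin_eq.
- move=> b Q; rewrite /= invD mulDD.
  rewrite (E2pi (_ : _ = - tau i beta + 2 * pi)); last by ring.
  move=> /(expC_sin_eq (2 * e)) <-; congr expC.
  by rewrite sinN sin_tau; field.
Qed.

(** * Conjugation invariance of the defining conditions *)

Definition conjby g q := (g * q * g^-1)%g.

Lemma conjbyM g p q : conjby g (p * q)%g = (conjby g p * conjby g q)%g.
Proof. by rewrite /conjby !mulgA mulgVK. Qed.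

Lemma conjbyV g q : conjby g (q^-1)%g = ((conjby g q)^-1)%g.
Proof. by rewrite /conjby !invgM invgK !mulgA. Qed.

Lemma conjby1 g : conjby g 1%g = 1%g.
Proof. by rewrite /conjby mulg1 mulgV. Qed.

Lemma conjby_sopp1 g : conjby g sopp1 = sopp1.
Proof. by rewrite /conjby -sopp1C mulgK. Qed.

Lemma pure_conjby g q : pureC q -> pureC (conjby g q).
Proof. by rewrite /pureC /= qre_conj. Qed.

Lemma conjbyK g q : conjby g^-1%g (conjby g q) = q.
Proof. by rewrite /conjby invgK !mulgA mulVg mul1g mulgVK. Qed.

(** A polar form of the conjugated longitude is carried back by [g^-1] to a polar form of [p] with
    the same angle. *)
Lemma perturbed_conjby (f : R -> R) g p q :
  perturbed f p q -> perturbed f (conjby g p) (conjby g q).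
Proof.
move=> pq beta Q pE.
have [P _ PE] := expC_conj g^-1%g Q.
have /pq qE : p = expC beta P by rewrite PE -[RHS]/(conjby _ _) -pE conjbyK.
by rewrite qE PE -/(conjby g^-1%g _) -{1}[g]invgK conjbyK.
Qed.

Lemma sharp_reps_conjby e g (r : tgen -> SU2 R) :
  sharp_reps e r -> sharp_reps e (fun x => conjby g (r x)).
Proof.
case=> -[[r1 r2 r3 r4] r5 r6 r7] [[ta tb tc td] th tm tn] rw rp1 rp2; split.
- split; [split|..] => /=; rewrite /comm_bar -?conjbyV -?conjbyM -?conjbyV -?conjbyM.
  + by rewrite -r1.
  + by rewrite -r2.
  + by rewrite -(conjby1 g) -[in RHS]r3.
  + by move: r4; rewrite /comm_bar => ->.
  + by rewrite -r5.
  + by rewrite -r6.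
  + by rewrite -(conjby1 g) -[in RHS]r7.
- by split; [split|..]; exact: pure_conjby.
- by rewrite /= rw conjby_sopp1.
- by rewrite /= -conjbyM; exact: perturbed_conjby.
- by rewrite /= -conjbyV -conjbyM; exact: perturbed_conjby.
Qed.

End NormalForm.

(** * Exhaustion by the normal form *)

Section Exhaustion.
Variable R : realType.
Implicit Types (s t e beta : R) (g p q : SU2 R) (P Q : Ci R) (i : bool).

Local Notation E t := (expC t kk).
Local Notation D t := (expC t kk * ii)%g.

Lemma pureCE q : pureC q = (qre (qval q) = 0).
Proof. by []. Qed.

Lemma sin_eq0_itv t : - pi < t < pi -> sin t = 0 -> t = 0.
Proof.
move=> /andP[t1 t2] st; have [t0|t0|//] := ltgtP t 0.
- have : 0 < sin (- t) by apply: sin_gt0_pi; rewrite oppr_gt0 t0 ltrNl.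
  by rewrite sinN st oppr0 ltxx.
- by have : 0 < sin t; [apply: sin_gt0_pi; rewrite t0|rewrite st ltxx].
Qed.

(** The product [c * x] has absolute value below 1 < pi, where sine has no zero but 0. Smallness of
    [e] enters the argument mainly through this fact. *)
Lemma sin_small_eq0 (c x : R) : 0 < c < 1 -> -1 <= x <= 1 -> sin (c * x) = 0 -> x = 0.
Proof.
move=> /andP[c0 c1] /andP[x1 x2] h; have pi2 := pi_ge2 R.
have : c * x = 0 by apply: sin_eq0_itv h; apply/andP; split; nra.
by move=> /eqP; rewrite mulf_eq0 gt_eqF//= => /eqP.
Qed.

Lemma sin_itv t : -1 <= sin t <= 1.
Proof. by rewrite sin_geN1 sin_le1. Qed.

(** Stands for q = b, p = p1, with h = i and a = j p1. Writing q i = e^{tQ}, tracelessness of j p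
    makes sin (e sin t) times the j-coordinate of [Q] vanish, so q i has no j-coordinate. It has no
    i-coordinate because [q] is pure. *)
Lemma longitude1_angle e q p : 0 < e < 1 -> pureC q -> pureC (jj R * p)%g ->
  perturbed (fun t => e * sin t) (q * ii)%g p -> exists beta, (q * ii)%g = E beta.
Proof.
move=> e1 /pure_coords[[[x y] z] [/= qE n1]].
have [t [Q qiE]] := polar_form (q * ii)%g.
have [[[u v] w] [QE /= n2]] := Ci_coords Q.
move=> pjp /(_ t Q qiE) pE.
move: pjp; rewrite pureCE pE qvalM jj_val (expCE _ QE) /=.
move=> jp; have {jp} sv : sin (e * sin t) * v = 0 by lra.
have qiv := congr1 (@qval R) qiE.
move: qiv; rewrite qvalM qE (expCE _ QE) /= /qmk => -[_ _ zv _].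
have z0 : z = 0.
  move/eqP: sv; rewrite mulf_eq0 => /orP[/eqP se|/eqP v0]; last by rewrite v0 in zv; lra.
  by move: zv; rewrite (sin_small_eq0 e1 (sin_itv t) se); lra.
have [beta [xb yb]] : exists beta, - x = cos beta /\ - y = sin beta.
  by apply: unit_angle; rewrite -n1 z0; ring.
exists beta; apply: val_inj; rewrite [RHS]Eval [LHS]qvalM qE z0 -xb -yb /= /qmk.
by congr (_, _, _, _); ring.
Qed.

(** Stands for q = a^-1 m, p = p2 and a = [D alpha]; the last hypothesis is d = p2^-1 a p2 with d
    already computed. The axis of [q] turns out to be k or -k, unless q is 1 or -1. *)
Lemma longitude2_angle e alpha beta q p : 0 < e < 1 / 4 ->
  pureC (D alpha * q)%g ->
  perturbed (fun t => 2 * e * sin t) q p ->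
  (p^-1 * D alpha * p)%g = D (alpha - 2 * (e * sin beta)) ->
  exists t, q = E t /\ sin t = 1 / 2 * sin beta.
Proof.
move=> /andP[e0 e1] paq pert pap.
have pi2 := pi_ge2 R.
have [t [Q qE]] := polar_form q.
have [[[u v] w] [QE /= n2]] := Ci_coords Q.
have pE := pert _ _ qE.
(* If sin t = 0 then p = 1, so conjugation by it moves nothing and the rotation by 2 e sin beta must
   be trivial. *)
have [st|st] := eqVneq (sin t) 0.
  have sb : sin beta = 0.
    move: pap; rewrite pE st mulr0 expC0 invg1 mul1g mulg1 => /mulIg/E_inj[hc hs].
    apply: (@sin_small_eq0 (2 * e)); [lra|exact: sin_itv|].
    rewrite (_ : 2 * e * sin beta = alpha - (alpha - 2 * (e * sin beta))); last by ring.
    by rewrite sinB -hc -hs; ring.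
  exists t; split; last by rewrite st sb mulr0.
  by apply: val_inj; rewrite qE [LHS](expCE _ QE) [RHS]Eval st !mul0r.
have av : cos alpha * u + sin alpha * v = 0.
  move: paq; rewrite pureCE qE qvalM Dval (expCE _ QE) /= => h.
  by apply: (mulfI st); lra.
(* By [av] the axis [Q] is orthogonal to the pure unit [D alpha], hence anticommutes with it. *)
have anti s : (D alpha * expC s Q = expC (- s) Q * D alpha)%g.
  apply: val_inj; rewrite [LHS]qvalM [RHS]qvalM Dval !(expCE _ QE) cosN sinN.
  rewrite /= /qmk; congr (_, _, _, _); try ring.
  - by have : sin s * (cos alpha * u + sin alpha * v) = 0; [rewrite av mulr0|move=> ?; lra].
set x := 2 * e * sin t in pE.
(* Moving p past [D alpha] inverts it, so p^-1 [D alpha] p = p^-2 [D alpha], and the factor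
   [D alpha] cancels. *)
have p2 : expC (2 * x) Q = E (2 * e * sin beta).
  have : (expC (- (2 * x)) Q * D alpha = E (- (2 * e * sin beta)) * D alpha)%g.
    rewrite mulED (_ : - (2 * e * sin beta) + alpha = alpha - 2 * (e * sin beta)).
      rewrite -pap pE expCV -[in RHS]mulgA anti [RHS]mulgA expCD.
      by congr (_ * _)%g; congr expC; ring.
    by ring.
  by move=> /mulIg; rewrite -!expCV => /invg_inj.
have [c2 [u0 [v0 w0]]] : cos (2 * x) = cos (2 * e * sin beta) /\
    (sin (2 * x) * u = 0 /\ (sin (2 * x) * v = 0 /\ sin (2 * x) * w = sin (2 * e * sin beta))).
  by have := congr1 (@qval R) p2; rewrite (expCE _ QE) Eval => -[].
(* Here the angle is 4 e sin t, which needs e < 1/4. Nonvanishing of its sine forces the axis to be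
   k or -k. *)
have sx : sin (2 * x) != 0.
  apply: contraNN st => /eqP; rewrite /x mulrA => h; apply/eqP.
  by apply: (sin_small_eq0 _ (sin_itv t) h); lra.
have {}u0 : u = 0 by apply: (mulfI sx); rewrite mulr0.
have {}v0 : v = 0 by apply: (mulfI sx); rewrite mulr0.
have w1 : w ^+ 2 = 1 by rewrite -n2 u0 v0; ring.
(* The sign [w] of the axis is absorbed into the angle. *)
have [t' [qt st']] : exists t', q = E t' /\ sin t' = w * sin t.
  have /orP[/eqP w_eq|/eqP w_eq] : (w == 1) || (w == -1) by rewrite -sqrf_eq1 w1.
  - exists t; split; last by rewrite w_eq mul1r.
    by apply: val_inj; rewrite qE [LHS](expCE _ QE) [RHS]Eval u0 v0 w_eq mulr1 mulr0.
  - exists (- t); split; last by rewrite w_eq mulN1r sinN.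
    apply: val_inj; rewrite qE [LHS](expCE _ QE) [RHS]Eval u0 v0 w_eq sinN cosN.
    by rewrite mulr0 mulrN1.
exists t'; split=> //.
have /andP[t1 t2] := sin_itv t'; have /andP[b1 b2] := sin_itv beta.
(* Both angles lie in [-pi/2, pi/2], so equality of their sines gives equality of the angles. *)
have : 2 * (2 * e * sin t') = 2 * e * sin beta.
  apply: sin_inj; rewrite ?in_itv /=; try (apply/andP; split; nra).
  rewrite -w0 st'.
  have /orP[/eqP w_eq|/eqP w_eq] : (w == 1) || (w == -1) by rewrite -sqrf_eq1 w1.
  - by rewrite w_eq mulr1 mul1r.
  - by rewrite w_eq mulN1r !mulrN sinN mulr1.
move=> h; have e2 : 2 * e != 0 by rewrite gt_eqF// mulr_gt0.
by apply: (mulfI e2); lra.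
Qed.

(** The first longitude gives [beta], and with it p1, a, b, c, d. The second longitude then gives
    the index [i], and with it p2, m, n. *)
Lemma model_of_frame e (r : tgen -> SU2 R) : 0 < e < 1 / 4 -> sharp_reps e r ->
  r Gh = ii -> (r Ga * (r Gp1)^-1)%g = jj R ->
  exists i beta, forall x, r x = model e i beta x.
Proof.
move=> e1 [[[r1 r2 r3 r4] r5 r6 r7] [[ta tb tc td] th tm tn] rw rp1 rp2] hE aE.
have {}aE : r Ga = (jj R * r Gp1)%g by rewrite -aE mulgVK.
have [beta bhE] : exists beta, (r Gb * ii)%g = E beta.
  apply: (@longitude1_angle e _ (r Gp1)) => //; first by lra.
  - by rewrite -aE.
  - by rewrite -hE.
have p1E : r Gp1 = E (e * sin beta) by apply: rp1; rewrite hE.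
have {}aE : r Ga = D (pi / 2 - e * sin beta) by rewrite aE p1E mulDE.
have iE : ii = D (0 : R) by rewrite expC0 mul1g.
have bE : r Gb = D (beta + pi).
  by apply: (mulIg ii); rewrite bhE {2}iE mulDD; symmetry; apply: E2pi; ring.
have cE : r Gc = D (beta + pi - 2 * (e * sin beta)).
  by rewrite r1 bE p1E expCV mulED mulDE; apply: D_congr; ring.
have dE : r Gd = D (pi / 2 - 3 * (e * sin beta)).
  rewrite r2 aE bE cE invD mulDD mulED.
  by congr (_ * _)%g; apply: E2pi; ring.
have [t [amE st]] : exists t, ((r Ga)^-1 * r Gm)%g = E t /\ sin t = 1 / 2 * sin beta.
  apply: (@longitude2_angle e (pi / 2 - e * sin beta) beta _ (r Gp2)) => //.
    by rewrite -aE mulVKg.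
  by rewrite -aE -r5 dE; apply: D_congr; ring.
have [i [ci si]] := tau_angle st.
have p2E : r Gp2 = E (e * sin beta).
  by rewrite (rp2 _ _ amE); apply: E_congr; rewrite st; field.
have mE : r Gm = D (pi / 2 - e * sin beta + tau i beta).
  apply: (mulgI (r Ga)^-1%g); rewrite amE (E_eq_cos_sin ci si) aE invD mulDD; symmetry.
  by apply: E2pi; ring.
have nE : r Gn = D (pi / 2 - 3 * (e * sin beta) + tau i beta).
  by rewrite r6 p2E mE expCV mulED mulDE; apply: D_congr; ring.
by exists i, beta; case=> //=; rewrite hE.
Qed.

(** In p q = - q p the cross products cancel from the imaginary part, leaving Re p times [q] equal
    to zero, while [q] has norm 1. *)
Lemma anticomm_pure p q : pureC q -> comm_bar p q = sopp1 -> pureC p.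
Proof.
move=> /pure_coords[[[x y] z] [/= qE n1]] pq.
have : (p * q)%g = (sopp1 * (q * p))%g by rewrite -pq /comm_bar mulgA !mulgVK.
move=> /(congr1 (@qval R)); rewrite pureCE !qvalM qE; case: (qval p) => [[[a b] c] d].
rewrite /= /qmk => -[_ h1 h2 h3].
have [ax ay] : a * x = 0 /\ a * y = 0 by split; lra.
by rewrite -[a]mulr1 -n1 !mulrDr !expr2 !mulrA ax ay (_ : a * z = 0); [ring|lra].
Qed.

Lemma sharp_reps_model e (r : tgen -> SU2 R) : 0 < e < 1 / 4 -> sharp_reps e r ->
  exists g i beta, forall x, conjby g (r x) = model e i beta x.
Proof.
move=> e1 re; have [[[_ _ _ r4] _ _ _] [[ta _ _ _] th _ _] rw rp1 _] := re.
(* As w = -1 is central, the right-hand side of the clasp relation collapses to -1. *)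
have xh : comm_bar (r Ga * (r Gp1)^-1)%g (r Gh) = sopp1.
  by rewrite r4 rw !mulgA -sopp1C -!mulgA (mulgA (r Ga)) mulgV mul1g mulgV mulg1.
have [] := @conj_frame R (r Ga * (r Gp1)^-1)%g (r Gh) _ th xh.
  exact: anticomm_pure th xh.
move=> g [gh ga]; exists g; apply: model_of_frame => //.
  exact: sharp_reps_conjby.
by rewrite -conjbyV -conjbyM.
Qed.

End Exhaustion.

(** * The parametrization *)

Section Topology.

(** A compact-to-Hausdorff argument in which Hausdorffness of [Y] is replaced by a map [G] to a
    Hausdorff space that separates the points of the image. *)
Lemma compact_homeomorphism (X Y Z : topologicalType) (f : X -> Y) (G : Y -> Z) :
  compact [set: X] -> hausdorff_space Z -> continuous f -> continuous G ->
  injective (G \o f) -> (forall y, exists x, f x = y) -> homeomorphism f.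
Proof.
move=> cX hZ cf cG injGf /choice[g fg]; split=> //; exists g; split=> //; last first.
  by move=> x; apply: injGf => /=; rewrite fg.
apply/continuous_closedP => A cA.
(* The image of the closed set [A] under [G \o f] is compact, hence closed in [Z]; pulling it back
   by [G] gives a closed set. *)
have -> : g @^-1` A = G @^-1` ((G \o f) @` A).
  apply/seteqP; split=> y /=; first by move=> Agy; exists (g y); rewrite //= fg.
  by move=> [x Ax GE]; rewrite (_ : g y = x)//; apply: injGf; rewrite /= fg.
have cGf : continuous (G \o f) by move=> x; apply: continuous_comp; [exact: cf|exact: cG].
apply: (proj1 (continuous_closedP G) cG); apply: compact_closed => //.
apply: continuous_compact; first exact: continuous_subspaceT.
exact: subclosed_compact cA cX _.
Qed.

Lemma continuous_ptws (T : topologicalType) (I : Type) (K : topologicalType)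
  (f : T -> {ptws I -> K}) :
  (forall i, continuous (fun t => f t i)) -> continuous f.
Proof.
move=> cf t; apply/cvg_sup => i.
exact: (continuous_comp_initial (w := fun h : I -> K => h i) (cf i)).
Qed.

Lemma continuous_pair (T X Y : topologicalType) (f : T -> X) (g : T -> Y) :
  continuous f -> continuous g -> continuous (fun x => (f x, g x)).
Proof. by move=> cf cg x; exact: cvg_pair (cf x) (cg x). Qed.

Lemma continuous_compT (T X Y : topologicalType) (f : T -> X) (g : X -> Y) :
  continuous f -> continuous g -> continuous (fun x => g (f x)).
Proof. by move=> cf cg x; exact: continuous_comp (cf x) (cg _). Qed.

Lemma continuous_bool_prod (X Y : topologicalType) (f : bool * X -> Y) :
  (forall i, continuous (fun x => f (i, x))) -> continuous f.
Proof.
move=> cf [i x] A /= /(cf i x) fA.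
exists ([set i], [set y | A (f (i, y))]); first by split.
by move=> [j y] /= [-> ].
Qed.

End Topology.

(** * The circle as a compact quotient of the line *)

Section CircleTopology.
Variable R : realType.

Lemma circle_ptP (s t : R) :
  circle_pt s = circle_pt t <-> exists k : int, t = s + k%:~R * (2 * pi).
Proof.
split; first by move=> /eqquotP/asboolP.
by move=> h; apply/eqquotP/asboolP.
Qed.

Lemma circle_ptK (z : circle R) : circle_pt (repr z) = z.
Proof. exact: reprK. Qed.

Lemma circle_pt_continuous : continuous (@circle_pt R).
Proof. exact: pi_continuous. Qed.

Lemma circle_pt_itv (z : circle R) : exists2 t, 0 <= t <= 2 * pi & circle_pt t = z.
Proof.
have pi2 : 0 < 2 * pi :> R by rewrite mulr_gt0 ?pi_gt0.
pose x := repr z / (2 * pi); pose k := Num.floor x.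
have zE : repr z = x * (2 * pi) by rewrite /x mulfVK ?gt_eqF.
exists (repr z - k%:~R * (2 * pi)).
  rewrite zE -mulrBl; apply/andP; split.
    by rewrite mulr_ge0 ?(ltW pi2)// subr_ge0 ge_floor.
  rewrite -[leRHS]mul1r ler_pM2r//.
  by have := lt_succ_floor x; rewrite -/k intrD; lra.
rewrite -[RHS]circle_ptK; apply/circle_ptP; exists k; by ring.
Qed.

Lemma circle_compact : compact [set: circle R].
Proof.
have -> : [set: circle R] = @circle_pt R @` `[0, 2 * pi].
  apply/seteqP; split=> // z _; have [t t01 tz] := circle_pt_itv z.
  by exists t => //=; rewrite in_itv.
apply: continuous_compact; last exact: segment_compact.
exact/continuous_subspaceT/circle_pt_continuous.
Qed.

End CircleTopology.

Section Parametrization.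
Variable R : realType.
Implicit Types (s t e beta : R) (i : bool).

Local Notation E t := (expC t kk).
Local Notation D t := (expC t kk * ii)%g.

Definition ord40 : 'I_4 := @Ordinal 4 0 isT.
Definition ord41 : 'I_4 := @Ordinal 4 1 isT.
Definition ord42 : 'I_4 := @Ordinal 4 2 isT.
Definition ord43 : 'I_4 := @Ordinal 4 3 isT.

Lemma quatE (q : quat R) :
  q = (qcoord ord40 q, qcoord ord41 q, qcoord ord42 q, qcoord ord43 q).
Proof. by case: q => [[[x y] z] w]. Qed.

Section Coord.
Variable T : topologicalType.
Implicit Types f g : T -> SU2 R.

(** Continuity into SU(2) is tested on the four real coordinates, where the group operations become
    polynomials. *)
Definition coord_continuous f :=
  forall l, continuous (fun x => qcoord l (qval (f x)) : R).

Lemma coord_continuous_continuous f : coord_continuous f -> continuous f.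
Proof.
move=> cf; apply: continuous_comp_initial.
rewrite (_ : _ \o _ = fun x => (qcoord ord40 (qval (f x)),
  qcoord ord41 (qval (f x)), qcoord ord42 (qval (f x)), qcoord ord43 (qval (f x)))).
  by do 3! [apply: continuous_pair => //].
by apply/funext => y; rewrite -quatE.
Qed.

Lemma qcoord_continuous l : continuous (qcoord l : R * R * R * R -> R).
Proof.
have c1 (X Y : topologicalType) : continuous (@fst X Y) by move=> ?; exact: cvg_fst.
have c2 (X Y : topologicalType) : continuous (@snd X Y) by move=> ?; exact: cvg_snd.
case: l => -[|[|[|[|//]]]] h.
- rewrite (_ : qcoord _ = fun q => q.1.1.1); last by apply/funext => -[[[]]].
  exact: continuous_compT (continuous_compT (c1 _ _) (c1 _ _)) (c1 _ _).
- rewrite (_ : qcoord _ = fun q => q.1.1.2); last by apply/funext => -[[[]]].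
  exact: continuous_compT (continuous_compT (c1 _ _) (c1 _ _)) (c2 _ _).
- rewrite (_ : qcoord _ = fun q => q.1.2); last by apply/funext => -[[[]]].
  exact: continuous_compT (c1 _ _) (c2 _ _).
- rewrite (_ : qcoord _ = fun q => q.2); last by apply/funext => -[[[]]].
  exact: c2.
Qed.

Lemma continuous_coord f : continuous f -> coord_continuous f.
Proof.
move=> cf l; apply: continuous_compT (@qcoord_continuous l).
by apply: continuous_compT cf _; exact: initial_continuous.
Qed.

Lemma coord_continuousM f g : coord_continuous f -> coord_continuous g ->
  coord_continuous (fun x => f x * g x)%g.
Proof.
move=> cf cg l.
have cM k m : continuous (fun x => qcoord k (qval (f x)) * qcoord m (qval (g x)) : R).
  by move=> x; apply: cvgM; [exact: cf|exact: cg].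
have cE h : (forall x, qcoord l (qmul (qval (f x)) (qval (g x))) = h x) ->
    continuous (h : T -> R) ->
    continuous (fun x => qcoord l (qval (f x * g x)%g) : R).
  by move=> hE; rewrite (_ : (fun x => _) = h)//; apply/funext.
case: l cE => -[|[|[|[|//]]]] hl cE.
- apply: (cE (fun x => qcoord ord40 (qval (f x)) * qcoord ord40 (qval (g x))
    - qcoord ord41 (qval (f x)) * qcoord ord41 (qval (g x))
    - qcoord ord42 (qval (f x)) * qcoord ord42 (qval (g x))
    - qcoord ord43 (qval (f x)) * qcoord ord43 (qval (g x)))) => x.
    by case: (qval (f x)) (qval (g x)) => [[[? ?] ?] ?] [[[? ?] ?] ?].
  by apply: cvgB; [apply: cvgB; [apply: cvgB|]|]; exact: cM.
- apply: (cE (fun x => qcoord ord40 (qval (f x)) * qcoord ord41 (qval (g x))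
    + qcoord ord41 (qval (f x)) * qcoord ord40 (qval (g x))
    + qcoord ord42 (qval (f x)) * qcoord ord43 (qval (g x))
    - qcoord ord43 (qval (f x)) * qcoord ord42 (qval (g x)))) => x.
    by case: (qval (f x)) (qval (g x)) => [[[? ?] ?] ?] [[[? ?] ?] ?].
  by apply: cvgB; [apply: cvgD; [apply: cvgD|]|]; exact: cM.
- apply: (cE (fun x => qcoord ord40 (qval (f x)) * qcoord ord42 (qval (g x))
    - qcoord ord41 (qval (f x)) * qcoord ord43 (qval (g x))
    + qcoord ord42 (qval (f x)) * qcoord ord40 (qval (g x))
    + qcoord ord43 (qval (f x)) * qcoord ord41 (qval (g x)))) => x.
    by case: (qval (f x)) (qval (g x)) => [[[? ?] ?] ?] [[[? ?] ?] ?].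
  by apply: cvgD; [apply: cvgD; [apply: cvgB|]|]; exact: cM.
- apply: (cE (fun x => qcoord ord40 (qval (f x)) * qcoord ord43 (qval (g x))
    + qcoord ord41 (qval (f x)) * qcoord ord42 (qval (g x))
    - qcoord ord42 (qval (f x)) * qcoord ord41 (qval (g x))
    + qcoord ord43 (qval (f x)) * qcoord ord40 (qval (g x)))) => x.
    by case: (qval (f x)) (qval (g x)) => [[[? ?] ?] ?] [[[? ?] ?] ?].
  by apply: cvgD; [apply: cvgB; [apply: cvgD|]|]; exact: cM.
Qed.

Lemma coord_continuousV f : coord_continuous f -> coord_continuous (fun x => (f x)^-1%g).
Proof.
move=> cf l.
have cN m : continuous (fun x => - qcoord m (qval (f x)) : R).
  by move=> x; apply: cvgN; exact: cf.
have qc : forall q : quat R,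
    qconj q = (qcoord ord40 q, - qcoord ord41 q, - qcoord ord42 q, - qcoord ord43 q).
  by case=> [[[? ?] ?] ?].
rewrite (_ : (fun x => _) = fun x => qcoord l (qcoord ord40 (qval (f x)),
  - qcoord ord41 (qval (f x)), - qcoord ord42 (qval (f x)), - qcoord ord43 (qval (f x)))).
  case: l => -[|[|[|[|//]]]] h; [exact: cf|exact: cN..].
by apply/funext => x /=; rewrite qc.
Qed.

End Coord.

(** The parameter enters the angles only through its sine or with coefficient 1, so a period shifts
    every angle by a multiple of 2 pi. *)
Lemma model_periodic e i beta (k : int) :
  model e i (beta + k%:~R * (2 * pi)) = model e i beta.
Proof.
have tE : tau i (beta + k%:~R * (2 * pi)) = tau i beta by rewrite /tau sinD2piz.
have DE t : D (t + k%:~R * (2 * pi)) = D t.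
  by congr (_ * _)%g; apply: E_eq_cos_sin; rewrite ?cosD2piz ?sinD2piz.
apply/funext; case => //=; rewrite ?tE ?sinD2piz//.
  by rewrite -(DE (beta + pi)); apply: D_congr; ring.
by rewrite -(DE (beta + pi - _)); apply: D_congr; ring.
Qed.

Definition model_rep e i beta : set_type (@sharp_reps R e) :=
  SigSub (mem_set (modelP e i beta)).

(** A real representative of the circle point is chosen by [repr]; [PhiE] shows that the choice does
    not matter. *)
Definition Phi e (z : bool * circle R) : Rsharp e :=
  conj_class (model_rep e z.1 (repr z.2)).

Lemma PhiE e i beta : Phi e (i, circle_pt beta) = conj_class (model_rep e i beta).
Proof.
have [k bE] : exists k : int, beta = repr (circle_pt beta) + k%:~R * (2 * pi).
  by apply/circle_ptP; rewrite circle_ptK.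
have mE : model e i beta = model e i (repr (circle_pt beta)).
  by move: bE; set b := repr _ => ->; exact: model_periodic.
apply/conj_classP; exists 1%g => x; rewrite mul1g invg1 mulg1.
exact: (congr1 (fun r => r x) mE).
Qed.

Lemma conjby_ED s t : conjby (E s) (D t) = D (t + 2 * s).
Proof. by rewrite /conjby expCV mulED mulDE; apply: D_congr; ring. Qed.

Lemma restriction_Phi e i beta :
  restriction (Phi e (i, circle_pt beta)) = pillow_pt (rho e i beta).
Proof.
rewrite PhiE restrictionE; apply/conj_classP.
(* Conjugation by [E s] adds 2 s to the angle of [D], so this [s] brings m to [D 0], that is, to
   i. *)
pose s := - (pi / 2 - e * sin beta + tau i beta) / 2.
suff cE x : pillow_assign (rho e i beta) x = conjby (E s) (model e i beta (to_tgen x)).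
  by exists (E s) => x; exact: cE.
case: x; rewrite [LHS]/pillow_assign [to_tgen _]/= [model _ _ _ _]/model conjby_ED.
- by rewrite -[LHS]mul1g -(expC0 kk); apply: D_congr; rewrite /s; field.
- by apply: D_congr; rewrite /s /rho /=; field.
- by apply: D_congr; rewrite /s /rho /=; field.
- by apply: D_congr; rewrite /s /rho /=; field.
Qed.

Lemma Phi_surj e (z : Rsharp e) : 0 < e < 1 / 4 -> exists x, Phi e x = z.
Proof.
move=> e1.
have [r rz] : exists r, conj_class r = z by exists (repr z); exact: reprK.
have [g [i [beta gr]]] := sharp_reps_model e1 (set_valP r).
exists (i, circle_pt beta); rewrite PhiE -rz; apply/conj_classP.
exists g^-1%g => x.
have -> : set_val (model_rep e i beta) x = conjby g (set_val r x) by exact/esym/gr.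
by rewrite -[RHS]/(conjby g^-1%g (conjby g _)) conjbyK.
Qed.

End Parametrization.

(** * Homeomorphism, smoothness and immersion *)

Section Homeomorphism.
Variable R : realType.
Implicit Types (s t e beta : R) (i : bool).

Local Notation E t := (expC t kk).
Local Notation D t := (expC t kk * ii)%g.

Lemma elementary_E (f : R -> R) l : elementary f ->
  elementary (fun t => qcoord l (qval (E (f t)))).
Proof.
move=> ef; rewrite (_ : (fun t => _) = fun t => qcoord l (cos (f t), 0, 0, sin (f t))).
  case: l => -[|[|[|[|//]]]] h; rewrite /qcoord /tnth /=.
  - exact: elementary_cos.
  - exact: elementary_cst.
  - exact: elementary_cst.
  - exact: elementary_sin.
by apply/funext => t; rewrite Eval.
Qed.

Lemma elementary_D (f : R -> R) l : elementary f ->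
  elementary (fun t => qcoord l (qval (D (f t)))).
Proof.
move=> ef; rewrite (_ : (fun t => _) = fun t => qcoord l (0, cos (f t), sin (f t), 0)).
  case: l => -[|[|[|[|//]]]] h; rewrite /qcoord /tnth /=.
  - exact: elementary_cst.
  - exact: elementary_cos.
  - exact: elementary_sin.
  - exact: elementary_cst.
by apply/funext => t; rewrite Dval.
Qed.

Lemma elementary_scale (c : R) (f : R -> R) : elementary f -> elementary (fun t => c * f t).
Proof. by apply: elementaryM; exact: elementary_cst. Qed.

Lemma elementaryB (f g : R -> R) : elementary f -> elementary g ->
  elementary (fun t => f t - g t).
Proof. by move=> ef eg; apply: elementaryD => //; exact: elementaryN. Qed.

Lemma elementary_sin_id : elementary (fun t : R => sin t).
Proof. by apply: elementary_sin; exact: elementary_id. Qed.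

Lemma elementary_tau i : elementary (@tau R i).
Proof.
have e1 : elementary (@tau R false).
  apply: elementary_asin => [|t]; last exact: half_sin_itv.
  exact/elementary_scale/elementary_sin_id.
by case: i => //; apply: elementaryB e1; exact: elementary_cst.
Qed.

Lemma elementary_model e i x l :
  elementary (fun t => qcoord l (qval (model e i t x))).
Proof.
have es := elementary_scale e elementary_sin_id.
have et := elementary_tau i; have ec := @elementary_cst R; have ei := @elementary_id R.
have es3 c k : elementary (fun t => c - k * (e * sin t)).
  by apply: elementaryB => //; exact: elementary_scale.
case: x.
- by apply: elementary_D; exact: elementaryB.
- by apply: elementary_D; exact: elementaryD.
- apply: elementary_D; apply: elementaryB; last exact: elementary_scale.
  exact: elementaryD.
- exact: elementary_D.
- exact: elementary_D.
- exact: elementary_cst.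
- exact: elementary_E.
- by apply: elementary_D; apply: elementaryD => //; exact: elementaryB.
- by apply: elementary_D; exact: elementaryD.
- exact: elementary_E.
Qed.

Lemma model_rep_continuous e i : continuous (model_rep e i).
Proof.
apply: continuous_comp_initial; apply: continuous_ptws => x.
apply: coord_continuous_continuous => l.
apply: elementary_continuous; exact: elementary_model.
Qed.

Lemma Phi_continuous e : continuous (@Phi R e).
Proof.
apply: continuous_bool_prod => i; apply/quotient_continuous.
rewrite (_ : _ \o _ = fun t => conj_class (model_rep e i t)).
  apply: (continuous_compT (@model_rep_continuous e i)).
  exact: pi_continuous.
by apply/funext => t; exact: PhiE.
Qed.

Definition invariants e (r : set_type (@sharp_reps R e)) : R * R * R :=
  (qre (qval (set_val r Gb * set_val r Gh)%g),
   qre (qval (set_val r Gb * (set_val r Ga * (set_val r Gp1)^-1))%g),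
   qre (qval ((set_val r Ga)^-1 * set_val r Gm)%g)).

Lemma invariants_conj e (r s : set_type (@sharp_reps R e)) :
  conj_class r = conj_class s -> invariants r = invariants s.
Proof.
move=> /conj_classP[g gE]; have {}gE x : set_val s x = conjby g (set_val r x) by exact: gE.
by rewrite /invariants !gE -!conjbyV -!conjbyM !qre_conj.
Qed.

Lemma invariants_continuous e : continuous (@invariants e).
Proof.
have qreE : (@qre R) = qcoord ord40 by apply/funext => -[[[]]].
have cv x : coord_continuous (fun r : set_type (@sharp_reps R e) => set_val r x).
  apply: continuous_coord.
  apply: (@continuous_compT _ {ptws tgen -> SU2 R} _ set_val (fun r => r x)).
    exact: initial_continuous.
  exact: (@proj_continuous tgen (fun=> SU2 R) x).
rewrite /invariants qreE; apply: continuous_pair; [apply: continuous_pair|].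
- by apply: coord_continuousM.
- by apply: coord_continuousM => //; apply: coord_continuousM => //; exact: coord_continuousV.
- by apply: coord_continuousM => //; exact: coord_continuousV.
Qed.

Lemma invariants_model e i beta :
  invariants (model_rep e i beta) = (cos beta, sin beta, cos (tau i beta)).
Proof.
have mE x : set_val (model_rep e i beta) x = model e i beta x by [].
rewrite /invariants !mE /model !(invD, expCV, mulDE, mulDD) !Eval /=.
(* The word b a p1^-1 has angle beta - pi/2 + 2 pi; this is how sin beta becomes a real part. *)
have sE : cos (beta - pi / 2) = sin beta by rewrite cosBpihalf.
have := cosD2piz beta 1; have := cosD2piz (beta - pi / 2) 1.
have := cosD2piz (tau i beta) (-1); rewrite mulrNz mulr1z !mul1r mulN1r sE => h1 h2 h3.
congr (_, _, _).
- by rewrite -[RHS]h3; congr cos; ring.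
- by rewrite -[RHS]h2; congr cos; field.
- by rewrite -[RHS]h1 -cosN; congr cos; field.
Qed.

Lemma Phi_homeomorphism e : 0 < e < 1 / 4 -> homeomorphism (@Phi R e).
Proof.
move=> e1.
pose G (z : Rsharp e) := invariants (repr (z : conj_classes (@sharp_reps R e))).
apply: (@compact_homeomorphism _ (Rsharp e) (R * R * R)%type (@Phi R e) G).
- rewrite -setXTT; apply: compact_setX; [exact: bool_compact|exact: circle_compact].
- exact: norm_hausdorff.
- exact: Phi_continuous.
(* The choice of representatives need not be continuous; conjugation invariance lets the invariants
   descend to the quotient. *)
- apply: repr_comp_continuous; first exact: invariants_continuous.
  by move=> r s /eqP/invariants_conj ->.
- have GE i beta : G (Phi e (i, circle_pt beta)) =
      (cos beta, sin beta, cos (tau i beta)).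
    by rewrite /G PhiE -(invariants_model e); apply: invariants_conj; exact: reprK.
  move=> [i z] [j w]; rewrite -(circle_ptK z) -(circle_ptK w).
  move: (repr z) (repr w) => s t /=; rewrite !GE => -[cst sst ct].
  congr (_, _); last exact/circle_ptP/cos_sin_inj.
  (* Equal sines give equal tau_1, so the third invariants agree up to sign; as cos tau_1 > 0, that
     sign tells the circles apart. *)
  have h : tau false s = tau false t by rewrite /tau sst.
  have := cos_tau_gt0 s; move: ct.
  by case: i j => -[]; rewrite ?cos_tau_true ?h //; lra.
- by move=> z; exact: Phi_surj.
Qed.

Lemma Phi_smooth e : smooth_parametrization (@Phi R e).
Proof.
move=> i t0; exists (model_rep e i); split.
  by move=> x l; apply: elementary_smooth; exact: elementary_model.
by near=> t; exact: PhiE.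
Unshelve. all: by end_near.
Qed.

Lemma elementary_rho e i :
  elementary (fun t => (rho e i t).1) /\ elementary (fun t => (rho e i t).2).
Proof.
have es := elementary_scale e elementary_sin_id.
have e0 : elementary (fun t => - tau i t + pi / 2 + t).
  apply: elementaryD (elementary_id _); apply: elementaryD (elementary_cst _).
  exact/elementaryN/elementary_tau.
by split; [exact: elementaryD|exact: elementaryB].
Qed.

(** The two cosines are the real parts of b m^-1 and c m^-1, which conjugation preserves. *)
Lemma pillow_pt_cos (z w : R * R) : pillow_pt z = pillow_pt w ->
  cos z.1 = cos w.1 /\ cos z.2 = cos w.2.
Proof.
move=> /conj_classP[g gE].
have {}gE x : pillow_assign w x = conjby g (pillow_assign z x) by exact: gE.
have cE x : cos x = qre (qval (expC x kk)) :> R by rewrite Eval.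
have bE u : expC u.1 kk = (pillow_assign u Pb * (pillow_assign u Pm)^-1)%g :> SU2 R.
  by rewrite mulgK.
have dE u : expC u.2 kk = (pillow_assign u Pc * (pillow_assign u Pm)^-1)%g :> SU2 R.
  by rewrite mulgK.
by split; rewrite !cE ?bE ?dE !gE -conjbyV -conjbyM qre_conj.
Qed.

Lemma pillow_corner_sin (z : R * R) : pillow_corners (pillow_pt z) ->
  sin z.1 = 0 /\ sin z.2 = 0.
Proof.
move=> [k [l /pillow_pt_cos[/= c1 c2]]].
have h (x : R) (n : int) : cos x = cos (n%:~R * pi) -> sin x = 0.
  move=> cE; apply/eqP; rewrite -sqrf_eq0 sin2cos2 cE -sin2cos2.
  by rewrite sinz_pi expr0n.
by split; [exact: h c1|exact: h c2].
Qed.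

Lemma is_derive_scale_sin (c : R) t :
  is_derive t (1 : R) (fun t => c * sin t) (c * cos t).
Proof.
have h : is_derive t (1 : R) (fun t => c * sin t) (c * cos t + sin t * 0).
  exact: is_deriveM.
by apply: is_derive_eq h _; rewrite mulr0 addr0.
Qed.

(** Only the factor cos t matters for the immersion: [tau i] is stationary wherever cos t
    vanishes. *)
Lemma is_derive_tau i t : exists c : R, is_derive t (1 : R) (tau i) (c * cos t).
Proof.
have [c dc] : exists c : R, is_derive t (1 : R) (tau false) (c * cos t).
  exists ((Num.sqrt (1 - (- (1 / 2) * sin t) ^+ 2))^-1 * - (1 / 2)).
  rewrite -mulrA; apply: (@is_derive1_comp _ asin (fun t => - (1 / 2) * sin t)).
  exact/is_derive1_asin/half_sin_itv.
case: i; last by exists c.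
exists (- c); rewrite mulNr -[X in is_derive _ _ _ X]sub0r.
exact: is_deriveB.
Qed.

Lemma Phi_immersion e : 0 < e < 1 / 4 -> immersion_along (@Phi R e) (@restriction R e).
Proof.
move=> /andP[e0 e1] i t0.
have RE t : restriction (Phi e (i, circle_pt t)) = pillow_pt (rho e i t).
  exact: restriction_Phi.
have pi2 := pi_ge2 R; split.
  rewrite RE => /pillow_corner_sin[s1 s2].
  (* At a corner the difference of the coordinates, 2 e sin t0, has sine zero, and [e] is too small
     for that unless sin t0 = 0. *)
  have s0 : sin t0 = 0.
    apply: (@sin_small_eq0 _ (2 * e)); [lra|exact: sin_itv|].
    rewrite (_ : 2 * e * sin t0 = (rho e i t0).1 - (rho e i t0).2); last first.
      by rewrite /rho /=; ring.
    by rewrite sinB s1 s2 mul0r mulr0 subrr.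
  have st : sin (tau i t0) = 0 by rewrite sin_tau s0 mulr0.
  (* With both sines zero, the sine of the first coordinate is cos t0 cos tau, a product of two
     nonzero numbers. *)
  move: s1; rewrite /rho /= s0 mulr0 addr0.
  rewrite (_ : _ + t0 = (t0 - tau i t0) + pi / 2); last by ring.
  rewrite sinDpihalf cosB s0 mul0r addr0 => /eqP; rewrite mulf_eq0 => /orP[] /eqP c0.
    by have := cos2Dsin2 t0; rewrite c0 s0; lra.
  by have := cos2Dsin2 (tau i t0); rewrite c0 st; lra.
have [er1 er2] := elementary_rho e i.
exists (fun t => (rho e i t).1), (fun t => (rho e i t).2); split.
- exact: elementary_smooth.
- exact: elementary_smooth.
- by near=> t; rewrite RE -surjective_pairing.
have [c dc] := is_derive_tau i t0.
have dl : is_derive t0 (1 : R) (fun t => - tau i t + pi / 2 + t) (- (c * cos t0) + 0 + 1).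
  by apply: is_deriveD.
have ds : is_derive t0 (1 : R) (fun t => e * sin t) (e * cos t0).
  exact: is_derive_scale_sin.
have d1 : is_derive t0 (1 : R) (fun t => (rho e i t).1) (- (c * cos t0) + 0 + 1 + e * cos t0).
  exact: is_deriveD.
have d2 : is_derive t0 (1 : R) (fun t => (rho e i t).2) (- (c * cos t0) + 0 + 1 - e * cos t0).
  exact: is_deriveB.
rewrite !derive1E; case: d1 => _ ->; case: d2 => _ -> [h1 h2].
(* The difference of the two derivatives is 2 e cos t0. If it vanishes, each derivative equals 1. *)
have /eqP : e * cos t0 = 0 by lra.
rewrite mulf_eq0 gt_eqF//= => /eqP ct; move: h1; rewrite ct !mulr0; lra.
Unshelve. all: by end_near.
Qed.

(** Each coordinate differs from its limit by e sin t up to sign, and |e sin t| <= |e|. *)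
Lemma rho_uniform_cvg i :
  {uniform, (fun e : R => rho e i) @ (0 : R)^'+ --> rho (0 : R) i}.
Proof.
move=> A /uniform_nbhs[V [/=]]; rewrite -entourage_ballE => -[d /= d0 dV] VA.
near=> e; apply: VA => t _; apply: dV.
have ed : `|e| < d.
  by rewrite gtr0_norm; near: e; [exact: nbhs_right_lt|exact: nbhs_right_gt].
have sd : `|e * sin t| < d.
  by rewrite normrM (le_lt_trans _ ed)// ler_piMr// sin_max.
split; rewrite /ball /= /rho /= mul0r.
  by rewrite addr0 opprD addNKr normrN.
by rewrite subr0 opprB addrC subrK.
Unshelve. all: by end_near.
Qed.

End Homeomorphism.

(** * The limit at e = 0 *)

Section Limit.
Variable R : realType.
Implicit Types (s t x y psi beta : R) (i : bool).

Local Notation E t := (expC t kk).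
Local Notation D t := (expC t kk * ii)%g.

Definition lift0 i beta : R := - tau i beta + pi / 2 + beta.

Lemma rho0E i beta : rho 0 i beta = (lift0 i beta, lift0 i beta).
Proof. by rewrite /rho !mul0r addr0 subr0. Qed.

Lemma lift0D2piz i beta (k : int) :
  lift0 i (beta + k%:~R * (2 * pi)) = lift0 i beta + k%:~R * (2 * pi).
Proof. by rewrite /lift0 /tau sinD2piz; ring. Qed.

(* Both conditions say that [tan a] is [c * sin psi / (1 + c * cos psi)]. *)
Lemma kepler_solution (c psi : R) : -1 < c < 1 -> exists a,
  [/\ - (pi / 2) < a < pi / 2, sin a = c * sin (psi - a) &
   forall b, - (pi / 2) < b < pi / 2 -> sin b = c * sin (psi - b) -> b = a].
Proof.
move=> /andP[c1 c2].
have den : 1 + c * cos psi != 0.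
  rewrite gt_eqF//; have := cos_geN1 psi; have := cos_le1 psi => h1 h2.
  have [c0|c0] := leP 0 c; nra.
have kE a : - (pi / 2) < a < pi / 2 ->
    sin a = c * sin (psi - a) <-> tan a = c * sin psi / (1 + c * cos psi).
  move=> /cos_gt0_pihalf ca; have ca0 : cos a != 0 by rewrite gt_eqF.
  rewrite sinB /tan; split=> [h|h].
    apply/eqP; rewrite eqr_div//; apply/eqP.
    by rewrite mulrDr mulr1 {1}h; ring.
  have {}h : sin a * (1 + c * cos psi) = c * sin psi * cos a.
    by apply/eqP; rewrite -eqr_div//; apply/eqP.
  by move: h; rewrite mulrDr mulr1 => h; lra.
pose a := atan (c * sin psi / (1 + c * cos psi)).
have aB : - (pi / 2) < a < pi / 2 by rewrite atan_gtNpi2 atan_ltpi2.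
exists a; split=> //; first by apply/(kE a aB); rewrite atanK.
by move=> b bB /(kE b bB) bE; rewrite /a -bE tanK ?in_itv.
Qed.

(** The sign of tau_1 in [lift0], which allows both components to be treated at once. *)
Definition sgn i : R := if i then 1 else -1.

Lemma lift0_tau i beta : lift0 i beta =
  beta + sgn i * tau false beta - sgn i * (pi / 2).
Proof. by case: i; rewrite /lift0 /sgn /tau /=; field. Qed.

Lemma sgn_sin i x : sin (sgn i * x) = sgn i * sin x.
Proof. by case: i; rewrite /sgn ?mul1r // !mulN1r sinN. Qed.

Lemma sgn_itv i : -1 < - (sgn i / 2) < 1.
Proof. by case: i; rewrite /sgn; apply/andP; split; lra. Qed.

Lemma tau_itv i beta : - (pi / 2) < sgn i * tau false beta < pi / 2.
Proof.
have /andP[h1 h2] := half_sin_itv beta.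
have t1 : - (pi / 2) < tau false beta by rewrite asin_gtNpi2// h1 ltW.
have t2 : tau false beta < pi / 2 by rewrite asin_ltpi2// h2 ltW.
by case: i; rewrite /sgn; [rewrite mul1r t1 t2|rewrite mulN1r ltrN2 t2 ltrNl t1].
Qed.

Lemma tau_sin i beta :
  sin (sgn i * tau false beta) = - (sgn i / 2) * sin beta.
Proof. by rewrite sgn_sin sin_tau; field. Qed.

(** The lift determines psi = beta + a with a = sgn tau_1(beta), and [a] solves sin a = c sin (psi -
    a) for c = - sgn / 2. Uniqueness of the solution recovers [a], and then beta. *)
Lemma lift0_inj i : injective (lift0 i).
Proof.
move=> x y; rewrite !lift0_tau => xy.
pose psi := x + sgn i * tau false x.
have [a [_ _ aU]] := kepler_solution psi (sgn_itv i).
have xa : sgn i * tau false x = a.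
  apply: aU; first exact: tau_itv.
  by rewrite tau_sin /psi addrK.
have ya : sgn i * tau false y = a.
  apply: aU; first exact: tau_itv.
  by rewrite tau_sin (_ : psi = y + sgn i * tau false y) ?addrK// /psi; lra.
by move: xy; rewrite xa ya; lra.
Qed.

(** The existence half of [kepler_solution]: psi is read off from the required value, and beta = psi
    - a. *)
Lemma lift0_surj i x : exists beta, lift0 i beta = x.
Proof.
have [a [aB aE _]] := kepler_solution (x + sgn i * (pi / 2)) (sgn_itv i).
exists (x + sgn i * (pi / 2) - a); set beta := _ - a in aE *.
suff tE : sgn i * tau false beta = a by rewrite lift0_tau tE /beta; ring.
apply: sin_inj.
- by rewrite in_itv/=; have /andP[/ltW -> /ltW ->] := tau_itv i beta.
- by rewrite in_itv/=; have /andP[/ltW -> /ltW ->] := aB.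
- by rewrite tau_sin aE.
Qed.

Lemma pillow_diagP x y : pillow_pt (x, x) = pillow_pt (y, y) <-> cos x = cos y.
Proof.
split=> [/pillow_pt_cos[]//|cE].
apply/conj_classP.
have e0 : expC (0 : R) kk = 1%g by exact: expC0.
have /orP[/eqP sE|/eqP sE] : (sin y == sin x) || (sin y == - sin x).
- by rewrite -eqf_sqr !sin2cos2 cE.
- exists 1%g => z; rewrite mul1g invg1 mulg1.
  have xy : expC x kk = expC y kk :> SU2 R by apply: E_eq_cos_sin.
  suff : pillow_assign (y, y) z = pillow_assign (x, x) z by [].
  by case: z; rewrite /pillow_assign ?xy ?subrr.
(* Conjugation by i fixes m = n = i and replaces e^{xk} by its inverse, which identifies x with
   -x. *)
- exists ii => z.
  suff : pillow_assign (y, y) z = (ii * pillow_assign (x, x) z * ii^-1)%g by [].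
  have iE : (ii * expC x kk)%g = (expC y kk * ii)%g :> SU2 R.
    rewrite -[ii in LHS]mul1g -e0 mulDE sub0r; congr (_ * _)%g.
    by apply: E_eq_cos_sin; rewrite ?cosN ?sinN.
  by case: z; rewrite /pillow_assign /= ?subrr ?e0 ?mul1g ?mulgA ?iE ?mulgK.
Qed.

Definition limit_map (z : bool * circle R) : pillowcase R :=
  pillow_pt (rho 0 z.1 (repr z.2)).

Lemma limit_mapE i beta : limit_map (i, circle_pt beta) = pillow_pt (rho 0 i beta).
Proof.
have [k bE] : exists k : int, beta = repr (circle_pt beta) + k%:~R * (2 * pi).
  by apply/circle_ptP; rewrite circle_ptK.
rewrite /limit_map /= !rho0E; apply/pillow_diagP.
by move: bE; set b := repr _ => ->; rewrite lift0D2piz cosD2piz.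
Qed.

Lemma cos_eq_itv x : exists2 g, 0 <= g <= pi & cos x = cos g.
Proof.
exists (acos (cos x)); last by rewrite acosK// in_itv/= cos_geN1 cos_le1.
by rewrite acos_ge0 ?acos_lepi// cos_geN1 cos_le1.
Qed.

Lemma range_limit_map : range limit_map = @diagonal_arc R.
Proof.
apply/seteqP; split=> P.
- move=> [[i z] _ <-]; rewrite -(circle_ptK z) limit_mapE rho0E.
  have [g gB gE] := cos_eq_itv (lift0 i (repr z)).
  by exists g; [rewrite /= in_itv|apply/pillow_diagP].
- move=> [g _ <-]; have [beta bE] := lift0_surj false g.
  by exists (false, circle_pt beta) => //; rewrite limit_mapE rho0E bE.
Qed.

Lemma cos_eq x y : cos x = cos y ->
  exists (k : int) (b : bool), x = (if b then y else - y) + k%:~R * (2 * pi).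
Proof.
move=> cE.
have /orP[/eqP sE|/eqP sE] : (sin x == sin y) || (sin x == - sin y).
- by rewrite -eqf_sqr !sin2cos2 cE.
- by have [k ->] := cos_sin_inj (esym cE) (esym sE); exists k, true.
- have [k ->] : exists k : int, x = - y + k%:~R * (2 * pi).
    by apply: cos_sin_inj; rewrite ?cosN ?sinN ?cE ?sE.
  by exists k, false.
Qed.

Lemma limit_map_fiber g : 0 < g < pi ->
  (limit_map @^-1` [set pillow_pt (g, g)] #= `I_4)%card.
Proof.
move=> g0.
have /choice[inv0 invK] : forall p : bool * R, exists beta, lift0 p.1 beta = p.2.
  by move=> p; exact: lift0_surj.
(* Of the two binary digits of [j], the parity selects the component and the other one the lift [g]
   or [- g]. *)
pose pt (j : nat) := (odd j,
  circle_pt (inv0 (odd j, if (j < 2)%N then g else - g))).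
have -> : limit_map @^-1` [set pillow_pt (g, g)] = pt @` `I_4.
  apply/seteqP; split=> [[i z] /=|].
    rewrite -(circle_ptK z) limit_mapE rho0E => /pillow_diagP/cos_eq[k [b bE]].
    have zE : repr z = inv0 (i, if b then g else - g) + k%:~R * (2 * pi).
      by apply: (@lift0_inj i); rewrite lift0D2piz (invK (i, _)).
    exists (i + 2 * ~~ b)%N; first by case: (i) b {bE zE} => -[].
    rewrite /pt oddD oddM /= addbF oddb.
    have -> : (i + 2 * ~~ b < 2)%N = b by case: (i) b {bE zE} => -[].
    by congr (_, _); apply/circle_ptP; exists k.
  move=> _ [j _ <-] /=; rewrite limit_mapE rho0E (invK (_, _)) /=.
  by apply/pillow_diagP; case: ifP => _; rewrite ?cosN.
apply: inj_card_eq => j k; rewrite !inE /= => j4 k4 [ojk].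
rewrite ojk => /circle_ptP[l /(congr1 (lift0 (odd k)))].
rewrite lift0D2piz !(invK (_, _)) /= => h.
(* For 0 < g < pi the lifts [g] and [- g] have sines of opposite sign, hence differ modulo 2 pi. *)
have sg : 0 < sin g by exact: sin_gt0_pi.
have jk : (j < 2)%N = (k < 2)%N.
  have : sin (if (k < 2)%N then g else - g) = sin (if (j < 2)%N then g else - g).
    by rewrite h sinD2piz.
  by case: ltnP => _; case: ltnP => _ //; rewrite sinN; lra.
by move: j k j4 k4 ojk jk {h} => [|[|[|[|//]]]] [|[|[|[|//]]]].
Qed.

(** The possible exceptions are the two ends of the arc, where [g] and [- g] agree modulo 2 pi. *)
Lemma limit_map_generic : generically_to_one 4 limit_map (@diagonal_arc R).
Proof.
apply: (sub_finite_set (B := [set pillow_pt (0, 0); pillow_pt (pi, pi)])).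
  move=> P [[g /=]]; rewrite in_itv/= => /andP[g0 g1] <- nf.
  have [->|g0'] := eqVneq g 0; first by left.
  have [->|g1'] := eqVneq g pi; first by right.
  exfalso; apply: nf; apply: limit_map_fiber.
  by rewrite !lt_neqAle g0 g1 g1' eq_sym g0'.
exact: finite_set2.
Qed.

End Limit.

Theorem theorem2 (R : realType) :
  (\forall e \near (0 : R)^'+,
     exists Phi : bool * circle R -> Rsharp e,
       [/\ homeomorphism Phi,
           smooth_parametrization Phi,
           immersion_along Phi (@restriction R e)
         & forall (i : bool) (beta : R),
             restriction (Phi (i, circle_pt beta)) = pillow_pt (rho e i beta)])
  /\ (forall i : bool,
        {uniform, (fun e : R => rho e i) @ (0 : R)^'+ --> rho (0 : R) i})
  /\ exists f0 : bool * circle R -> pillowcase R,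
       [/\ forall (i : bool) (beta : R),
             f0 (i, circle_pt beta) = pillow_pt (rho 0 i beta),
           range f0 = @diagonal_arc R
         & generically_to_one 4 f0 (@diagonal_arc R)].
Proof.
split; last split.
(* The bound 1/4 is the strongest one needed; it comes from the angle 4 e sin t in
   [longitude2_angle]. *)
- near=> e; have e1 : 0 < e < 1 / 4.
    by apply/andP; split; near: e; [exact: nbhs_right_gt|exact: nbhs_right_lt].
  exists (@Phi R e); split.
  + exact: Phi_homeomorphism.
  + exact: Phi_smooth.
  + exact: Phi_immersion.
  + exact: restriction_Phi.
- exact: rho_uniform_cvg.
- by exists (@limit_map R); split;
    [exact: limit_mapE|exact: range_limit_map|exact: limit_map_generic].
Unshelve. all: by end_near.
Qed.
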